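(* Let $\mathcal{U}$ be the set consisting of (a) all groups $\langle s,w,A\rangle$ where $A$ is a finite subgroup of $\mathrm{D}(5,\mathbb{C})$ invariant under conjugation by $\mathrm{Sym}(5)$ and not contained in the scalar matrices, and (b) all groups $\langle s, w c_{n+1}, A\rangle$ where $n\ge0$ and $A$ is a finite subgroup of $\mathrm{D}(5,\mathbb{C})$ invariant under conjugation by $\mathrm{Sym}(5)$ with $A\cap X_{\{3\}}=\Omega_nX_{\{3\}}$. Then every group in $\mathcal{U}$ is a finite irreducible subgroup of $\mathrm{M}(5,\mathbb{C})$ with permutation part $\mathrm{Alt}(5)$; every finite irreducible subgroup of $\mathrm{M}(5,\mathbb{C})$ with permutation part $\mathrm{Alt}(5)$ is $\mathrm{GL}(5,\mathbb{C})$-conjugate to a group in $\mathcal{U}$; and no two distinct groups in $\mathcal{U}$ are $\mathrm{GL}(5,\mathbb{C})$-conjugate.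
   Context: $\mathrm{M}(5,\mathbb{C})$ is the group of monomial matrices, $\mathrm{D}(5,\mathbb{C})$ the invertible diagonal matrices; permutations $\alpha$ are identified with permutation matrices $[\delta_{i\alpha,j}]_{i,j}$. The permutation part of $G\le \mathrm{M}(5,\mathbb{C})$ is its image under $dt\mapsto t$. $s$ is the permutation matrix of $(1,2,3,4,5)$ and $w$ that of $(1,2,3)$. For $n\ge1$, $c_n=\mathrm{diag}(1,\epsilon_n,\epsilon_n^{-1},\epsilon_n^{-1},\epsilon_n)$ with $\epsilon_n=e^{2\pi i/3^n}$. $X=\mathrm{SL}(5,\mathbb{C})\cap\mathrm{D}(5,\mathbb{C})$, $X_{\{3\}}$ is its subgroup of elements of $3$-power order, and $\Omega_nX_{\{3\}}=\{a\in X_{\{3\}}:a^{3^n}=1\}$. *)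

(* Defs.v *)
From HB Require Import structures.
From mathcomp Require Import all_boot all_order all_algebra all_fingroup.
From mathcomp Require Import alt.
From mathcomp Require Import complex.
From mathcomp Require Import classical_sets cardinality reals trigo.
Set Implicit Arguments. Unset Strict Implicit. Unset Printing Implicit Defensive.
Import Order.TTheory GRing.Theory Num.Theory.
Local Open Scope ring_scope.
Local Open Scope classical_set_scope.

Section Defs.
Variable R : realType.
Local Notation C := (R[i]).
Local Notation M5 := ('M[C]_5).

Definition is_subgroup (G : set M5) : Prop :=
  [/\ G 1%:M,
      (forall g h, G g -> G h -> G (g *m h)) &
      (forall g, G g -> g \in unitmx /\ G (invmx g))].

Definition gen (S : set M5) : set M5 :=
  [set g | forall H : set M5, is_subgroup H -> S `<=` H -> H g].

Definition Dmat : set M5 := [set d | is_diag_mx d /\ d \in unitmx].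

Definition Mmat : set M5 :=
  [set g | exists d (t : 'S_5), Dmat d /\ g = d *m perm_mx t].

Definition perm_part (G : set M5) : set 'S_5 :=
  [set t | exists d, Dmat d /\ G (d *m perm_mx t)].

Definition irreducible (G : set M5) : Prop :=
  forall U : M5, (forall g, G g -> (U *m g <= U)%MS) ->
    \rank U = 0%N \/ \rank U = 5%N.

Definition finite_subgroup_M (G : set M5) : Prop :=
  [/\ is_subgroup G, finite_set G & G `<=` Mmat].

Definition GLconj (G H : set M5) : Prop :=
  exists P : M5, P \in unitmx /\ H = (fun g => invmx P *m g *m P) @` G.

(* s = permutation matrix of (1,2,3,4,5), w = that of (1,2,3);
   the permutation matrix of alpha is [delta_{i alpha, j}] *)
Definition cyc5 (i : nat) : nat := (i.+1 %% 5)%N.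
Definition cyc3 (i : nat) : nat :=
  if (i == 0)%N then 1%N else if (i == 1)%N then 2%N else if (i == 2)%N then 0%N else i.
Definition smat : M5 := \matrix_(i < 5, j < 5) ((val j == cyc5 (val i))%:R).
Definition wmat : M5 := \matrix_(i < 5, j < 5) ((val j == cyc3 (val i))%:R).

Definition eps (n : nat) : C :=
  Complex (cos (2 * pi / (3 ^ n)%N%:R)) (sin (2 * pi / (3 ^ n)%N%:R)).

Definition cmat (n : nat) : M5 :=
  diag_mx (\row_(i < 5) [:: 1; eps n; (eps n)^-1; (eps n)^-1; eps n]`_i).

Definition Xgrp : set M5 := [set a | Dmat a /\ \det a = 1].
Definition X3 : set M5 := [set a | Xgrp a /\ exists k : nat, a ^+ (3 ^ k)%N = 1].
Definition Omega (n : nat) : set M5 := [set a | X3 a /\ a ^+ (3 ^ n)%N = 1].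

Definition sym_inv_diag (A : set M5) : Prop :=
  [/\ is_subgroup A, finite_set A, A `<=` Dmat &
      forall (t : 'S_5) a, A a -> A (invmx (perm_mx t) *m a *m perm_mx t)].

Definition scalars : set M5 := [set a | is_scalar_mx a].

Definition inU (G : set M5) : Prop :=
  (exists A, [/\ sym_inv_diag A, ~ (A `<=` scalars) &
      G = gen ([set smat; wmat] `|` A)]) \/
  (exists (n : nat) A, [/\ sym_inv_diag A, A `&` X3 = Omega n &
      G = gen ([set smat; wmat *m cmat n.+1] `|` A)]).

End Defs.

(* Main.v *)
(* Conjugating by a diagonal matrix, and raising entries to a power, turn a monomial lift of
   Alt(5) into one with entries in the cube roots of unity.  Let A be the diagonal part of G.

   If G is in U, its elements are products of an element of A and a monomial matrix whose
   entrywise 3^n-th power preserves one of two quadratic forms (the form with all off-diagonal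
   coefficients 1, or the cyclic "pentagon" form with coefficients 1 and omega); a diagonal
   automorphism of determinant 1 of such a form is trivial, so the diagonal part is exactly A.

   Conversely, A contains diag(.., x, .., x^-1, ..) for every ratio x of entries of one of its
   elements, the set of these x is the group of m-th roots of unity for some m, and A contains
   all determinant-1 diagonal matrices over it.  Lifting the 3-cycle (0 1 2) to a
   commutator and rescaling so that s lies in G, the relations of Alt(5) determine the m-th
   powers of the entries of this lift up to a cube root of unity; the transposition (3 4)
   exchanges the two nontrivial ones.

   Finally A is the largest abelian normal subgroup of G since Alt(5) is simple, so it is
   recovered up to conjugacy; if A is not scalar a conjugating matrix is monomial and hence
   fixes A, and the two families differ in the ratio of the entries of a lift of a 3-cycle
   at its two fixed points. *)
Require Import Defs.
From HB Require Import structures.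
From mathcomp Require Import all_boot all_order all_algebra all_fingroup.
From mathcomp Require Import gseries alt.
From mathcomp Require Import complex.
From mathcomp Require Import boolp classical_sets cardinality reals trigo.
From mathcomp Require Import ring.
Import Order.TTheory GRing.Theory Num.Theory.
Local Open Scope ring_scope.
Local Open Scope classical_set_scope.

(** * Monomial matrices and permutations of five points *)

Section Monomial.
Context {F : fieldType} {n : nat}.
Implicit Types (d e : 'I_n -> F) (s t u : 'S_n) (g : 'M[F]_n).

(** Storing the entries as a function of the row reduces products, inverses and conjugates of
    monomial matrices to identities between functions. *)
Definition mon d t : 'M[F]_n := \matrix_(i, j) (d i *+ (t i == j)).

Definition nowhere0 d := forall i, d i != 0.

Lemma mon_mul d e t u :
  mon d t *m mon e u = mon (fun i => d i * e (t i)) (t * u)%g.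
Proof.
apply/matrixP => i j; rewrite !mxE (bigD1 (t i)) //= big1 ?addr0 => [|k nk].
  by rewrite !mxE eqxx permM -mulrnAr.
by rewrite !mxE eq_sym (negbTE nk) mul0r.
Qed.

Lemma mon_diag_perm d t : diag_mx (\row_i d i) *m perm_mx t = mon d t.
Proof.
apply/matrixP => i j; rewrite mul_diag_mx !mxE.
by case: (t i == j); rewrite ?mulr1 ?mulr0.
Qed.

Lemma mon_perm t : mon (fun=> 1) t = perm_mx t.
Proof. by apply/matrixP => i j; rewrite !mxE. Qed.

Lemma mon_diag d : mon d 1 = diag_mx (\row_i d i).
Proof. by rewrite -mon_diag_perm perm_mx1 mulmx1. Qed.

Lemma mon1 : mon (fun=> 1) 1 = 1%:M.
Proof. by rewrite mon_perm perm_mx1. Qed.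

Lemma mon_row d t i : row i (mon d t) = d i *: delta_mx 0 (t i).
Proof.
apply/rowP => j; rewrite !mxE eqxx eq_sym /=.
by case: (_ == _); rewrite ?mulr1 ?mulr0.
Qed.

Lemma mon_inj {d e t u} : nowhere0 d -> mon d t = mon e u -> t = u /\ d = e.
Proof.
move=> nd E; have Et : t = u.
  apply/permP => i; have /matrixP/(_ i (t i)) := E; rewrite !mxE eqxx.
  by case: eqP => [->//|_] /eqP; rewrite (negbTE (nd i)).
split=> //; apply/funext => i; have /matrixP/(_ i (t i)) := E.
by rewrite !mxE Et eqxx.
Qed.

Lemma mon_unit d t : nowhere0 d -> mon d t \in unitmx.
Proof.
move=> nd; rewrite -mon_diag_perm unitmx_mul unitmx_perm andbT.
rewrite unitmxE det_diag unitfE.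
by apply/prodf_neq0 => i _; rewrite mxE nd.
Qed.

Lemma mon_invr d t : nowhere0 d ->
  invmx (mon d t) = mon (fun i => (d (t^-1%g i))^-1) t^-1%g.
Proof.
move=> nd; apply: (can_inj (mulKmx (mon_unit d t nd))).
rewrite mulmxV ?mon_unit // mon_mul mulgV -mon1.
by congr mon; apply/funext => i; rewrite permK mulfV.
Qed.

Lemma det_mon d t : \det (mon d t) = (-1) ^+ t * \prod_i d i.
Proof.
rewrite -mon_diag_perm det_mulmx det_diag det_perm mulrC.
by congr (_ * _); apply: eq_bigr => i _; rewrite mxE.
Qed.

Lemma mon_conj d e t u : nowhere0 e ->
  invmx (mon e u) *m mon d t *m mon e u =
  mon (fun i => (e (u^-1%g i))^-1 * d (u^-1%g i) * e (t (u^-1%g i))) (t ^ u)%g.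
Proof.
move=> ne; rewrite mon_invr // !mon_mul; congr mon; last by rewrite -mulgA.
by apply/funext => i; rewrite permM.
Qed.

Lemma nowhere0_mul d e : nowhere0 d -> nowhere0 e ->
  nowhere0 (fun i => d i * e i).
Proof. by move=> nd ne i; rewrite mulf_neq0. Qed.

Lemma nowhere0_inv d : nowhere0 d -> nowhere0 (fun i => (d i)^-1).
Proof. by move=> nd i; rewrite invr_eq0. Qed.

Lemma nowhere0_comp d t : nowhere0 d -> nowhere0 (fun i => d (t i)).
Proof. by move=> nd i. Qed.

End Monomial.

Lemma prod_nowhere0 {F : fieldType} {n} (d : 'I_n -> F) : \prod_i d i = 1 -> nowhere0 d.
Proof.
move=> E i; apply/eqP => di; move/eqP: E.
by rewrite (bigD1 i) //= di mul0r eq_sym oner_eq0.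
Qed.

Lemma mon_exp {F : fieldType} n (d : 'I_n.+1 -> F) k :
  mon d 1 ^+ k = mon (fun i => d i ^+ k) 1.
Proof.
elim: k => [|k IH]; first exact: (esym (@mon1 F n.+1)).
rewrite exprS IH; apply: etrans (mon_mul _ _ _ _) _.
by rewrite mulg1; congr mon; apply/funext => i; rewrite perm1 exprS.
Qed.

(** * The five points and generators of the alternating group *)

Notation o0 := (@Ordinal 5 0 isT).
Notation o1 := (@Ordinal 5 1 isT).
Notation o2 := (@Ordinal 5 2 isT).
Notation o3 := (@Ordinal 5 3 isT).
Notation o4 := (@Ordinal 5 4 isT).

Lemma forall5 (P : 'I_5 -> Prop) :
  P o0 -> P o1 -> P o2 -> P o3 -> P o4 -> forall i, P i.
Proof.
by move=> P0 P1 P2 P3 P4 [[|[|[|[|[|//]]]]] lti]; rewrite (bool_irrelevance lti isT).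
Qed.

Lemma ord5P (i : 'I_5) : i = o0 \/ i = o1 \/ i = o2 \/ i = o3 \/ i = o4.
Proof. by move: i; apply: forall5; tauto. Qed.

Lemma prod5 (F : comRingType) (d : 'I_5 -> F) :
  \prod_i d i = d o0 * d o1 * d o2 * d o3 * d o4.
Proof.
rewrite !big_ord_recl big_ord0 mulr1 !mulrA.
by congr (_ * _ * _ * _ * _); congr d; apply: val_inj.
Qed.

Fact cyc5_bound (i : 'I_5) : (cyc5 i < 5)%N. Proof. by rewrite ltn_pmod. Qed.
Fact cyc3_bound (i : 'I_5) : (cyc3 i < 5)%N. Proof. by move: i; apply: forall5. Qed.
Fact cyc5_inj : injective (fun i => Ordinal (cyc5_bound i)).
Proof. by elim/forall5; elim/forall5=> // /(congr1 val). Qed.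
Fact cyc3_inj : injective (fun i => Ordinal (cyc3_bound i)).
Proof. by elim/forall5; elim/forall5=> // /(congr1 val). Qed.

Definition sp : 'S_5 := perm cyc5_inj.
Definition wp : 'S_5 := perm cyc3_inj.

Lemma spE : (sp o0 = o1) * (sp o1 = o2) * (sp o2 = o3) * (sp o3 = o4) * (sp o4 = o0).
Proof. by do !split; rewrite permE; apply: val_inj. Qed.
Lemma wpE : (wp o0 = o1) * (wp o1 = o2) * (wp o2 = o0) * (wp o3 = o3) * (wp o4 = o4).
Proof. by do !split; rewrite permE; apply: val_inj. Qed.
Lemma spVE : (sp^-1 o0 = o4)%g * (sp^-1 o1 = o0)%g * (sp^-1 o2 = o1)%g * (sp^-1 o3 = o2)%g
   * (sp^-1 o4 = o3)%g.
Proof. by do !split; apply/(canLR (permK _)); rewrite spE. Qed.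
Lemma smatE (R : realType) : smat R = mon (fun=> 1) sp.
Proof.
by apply/matrixP => i j; rewrite !mxE permE -(inj_eq val_inj) /= eq_sym.
Qed.
Lemma wmatE (R : realType) : wmat R = mon (fun=> 1) wp.
Proof.
by apply/matrixP => i j; rewrite !mxE permE -(inj_eq val_inj) /= eq_sym.
Qed.

Lemma even_sp : odd_perm sp = false.
Proof.
have -> : sp = (tperm o0 o1 * tperm o0 o2 * tperm o0 o3 * tperm o0 o4)%g.
  by apply/permP; elim/forall5; rewrite !permM ?spE !permE.
by rewrite !odd_permM !odd_tperm.
Qed.
Lemma even_wp : odd_perm wp = false.
Proof.
have -> : wp = (tperm o0 o1 * tperm o0 o2)%g.
  by apply/permP; elim/forall5; rewrite !permM ?wpE !permE.
by rewrite !odd_permM !odd_tperm.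
Qed.

Lemma mem_Alt5 t : (t \in Alt 'I_5) = ~~ odd_perm t.
Proof. by rewrite Alt_even. Qed.

(* Successively fix the points 4, 3 and 0 by multiplying by elements of [T]:
   an even permutation fixing these three points is the identity. *)
Lemma Alt5_sub (T : {group 'S_5}) : sp \in T -> wp \in T ->
  forall t, ~~ odd_perm t -> t \in T.
Proof.
move=> Ts Tw t et.
(* The 3-cycle (1 2 3), which moves the point 3 while fixing 4 and 0. *)
pose y := (sp^-1 * wp * sp)%g.
have Ty : y \in T by rewrite !groupM ?groupV.
have yE : ((y o1 = o2) * (y o2 = o3) * (y o3 = o1) * (y o0 = o0) * (y o4 = o4))%type.
  by rewrite /y !permM ?spE ?spVE ?wpE ?spE.
have ey : ~~ odd_perm y by rewrite /y !odd_permM odd_permV even_sp even_wp.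
clearbody y.
have redu (u t' : 'S_5) : u \in T -> ~~ odd_perm u -> ~~ odd_perm t' ->
    (~~ odd_perm (t' * u)%g -> (t' * u)%g \in T) -> t' \in T.
  move=> Tu eu et' H; rewrite -(groupMr _ Tu); apply: H.
  by rewrite odd_permM (negbTE eu) (negbTE et').
have es : ~~ odd_perm sp by rewrite even_sp.
have ew : ~~ odd_perm wp by rewrite even_wp.
have avoid (t' : 'S_5) i j : t' i = i -> j != i -> t' j != i.
  by move=> ti ji; rewrite -{1}ti (inj_eq perm_inj).
have fix340 t' : ~~ odd_perm t' -> t' o4 = o4 -> t' o3 = o3 -> t' o0 = o0 -> t' \in T.
  move=> et' t4 t3 t0.
  suff -> : t' = 1%g by exact: group1.
  have A j i : t' i = i -> j != i -> t' j != i := @avoid t' i j.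
  have t1 : t' o1 = o1 \/ t' o1 = o2.
    move: (A o1 _ t0 isT) (A o1 _ t3 isT) (A o1 _ t4 isT).
    by case: (ord5P (t' o1)) => [->|[->|[->|[->|->]]]] //; [left|right].
  have t2 : t' o2 = o1 \/ t' o2 = o2.
    move: (A o2 _ t0 isT) (A o2 _ t3 isT) (A o2 _ t4 isT).
    by case: (ord5P (t' o2)) => [->|[->|[->|[->|->]]]] //; [left|right].
  case: t1 t2 => t1 [] t2.
  - by have := @perm_inj _ t' o1 o2; rewrite t1 t2 => /(_ erefl).
  - by apply/permP; apply: forall5; rewrite perm1.
  - suff E : t' = tperm o1 o2 by rewrite E odd_tperm in et'.
    by apply/permP; apply: forall5; rewrite permE.
  - by have := @perm_inj _ t' o1 o2; rewrite t1 t2 => /(_ erefl).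
have fix34 t' : ~~ odd_perm t' -> t' o4 = o4 -> t' o3 = o3 -> t' \in T.
  move=> et' t4 t3.
  have n3 := avoid t' o3 o0 t3 isT; have n4 := avoid t' o4 o0 t4 isT.
  case: (ord5P (t' o0)) => [t0|[t0|[t0|[t0|t0]]]].
  - exact: fix340.
  - do 2![apply: (redu wp) => // ?]; apply: fix340 => //; by rewrite !permM ?t4 ?t3 ?t0 !wpE.
  - apply: (redu wp) => // ?; apply: fix340 => //; by rewrite !permM ?t4 ?t3 ?t0 !wpE.
  - by rewrite t0 in n3.
  - by rewrite t0 in n4.
have fix4 t' : ~~ odd_perm t' -> t' o4 = o4 -> t' \in T.
  move=> et' t4; have n4 := avoid t' o4 o3 t4 isT.
  case: (ord5P (t' o3)) => [t3|[t3|[t3|[t3|t3]]]].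
  - apply: (redu wp) => // ?; do 2![apply: (redu y) => // ?].
    by apply: fix34 => //; rewrite !permM ?t4 ?t3 !wpE !yE.
  - do 2![apply: (redu y) => // ?]; apply: fix34 => //; by rewrite !permM ?t4 ?t3 !yE.
  - apply: (redu y) => // ?; apply: fix34 => //; by rewrite !permM ?t4 ?t3 !yE.
  - exact: fix34.
  - by rewrite t3 in n4.
case: (ord5P (t o4)) => [t4|[t4|[t4|[t4|t4]]]].
- do 4![apply: (redu sp) => // ?]; apply: fix4 => //; by rewrite !permM t4 !spE.
- do 3![apply: (redu sp) => // ?]; apply: fix4 => //; by rewrite !permM t4 !spE.
- do 2![apply: (redu sp) => // ?]; apply: fix4 => //; by rewrite !permM t4 !spE.
- apply: (redu sp) => // ?; apply: fix4 => //; by rewrite !permM t4 !spE.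
- exact: fix4.
Qed.

(** If the first candidate is odd, composing with (2 3), which fixes 0 and 1, corrects its
    parity. *)
Lemma even_transitive2 (i j : 'I_5) : i != j ->
  exists u : 'S_5, [/\ ~~ odd_perm u, u o0 = i & u o1 = j].
Proof.
move=> ij; pose j' := tperm o0 i j.
have nj' : j' != o0 by rewrite /j' -(inj_eq (@perm_inj _ (tperm o0 i))) tpermK tpermL eq_sym.
pose u := (tperm o1 j' * tperm o0 i)%g.
have u0 : u o0 = i by rewrite permM (tpermD _ nj') // tpermL.
have u1 : u o1 = j by rewrite permM tpermL tpermK.
case odd_u : (odd_perm u); last by exists u; rewrite odd_u.
exists (tperm o2 o3 * u)%g; split; first by rewrite odd_permM odd_tperm odd_u.
- by rewrite permM tpermD.
- by rewrite permM tpermD.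
Qed.

(** * Diagonal groups *)

Section DiagonalGroups.
Context {F : fieldType}.
Implicit Types (A : ('I_5 -> F) -> Prop) (d : 'I_5 -> F).

Definition diag_group A :=
  [/\ A (fun=> 1), forall d e, A d -> A e -> A (fun i => d i * e i),
      forall d, A d -> A (fun i => (d i)^-1) & forall d, A d -> nowhere0 d].

Definition even_inv A := forall (t : 'S_5) d, ~~ odd_perm t -> A d -> A (fun i => d (t i)).

Definition delta (k l : 'I_5) (x : F) : 'I_5 -> F :=
  fun i => if i == k then x else if i == l then x^-1 else 1.

Lemma prod_delta k l x : k != l -> x != 0 -> \prod_i delta k l x i = 1.
Proof.
move=> kl x0; rewrite (bigD1 k) //= (bigD1 l) 1?eq_sym //= big1 => [|i /andP[ik il]].
  by rewrite /delta !eqxx eq_sym (negbTE kl) mulr1 mulfV.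
by rewrite /delta (negbTE ik) (negbTE il).
Qed.

(* With [t = (0 1)(2 3)] and [x = d 1 / d 0], the quotient [b = d^t / d] is
   [(x, x^-1, y, y^-1, 1)]; moving it by the cycle [(0 1 4)] and dividing leaves
   [c = (x^-2, x, 1, 1, x)], and moving [c] by a cycle on [{2, 3, 4}] and dividing
   leaves [(1, 1, x, 1, x^-1)]. *)
Lemma ratio_delta A d i j k l : diag_group A -> even_inv A ->
  A d -> i != j -> k != l -> A (delta k l (d i / d j)).
Proof.
move=> [_ AM AV Anz] At Ad ij kl.
have AD e f : A e -> A f -> A (fun i => e i / f i) by move=> Ae /AV; exact: AM.
have base e : A e -> A (delta o2 o4 (e o1 / e o0)).
  move=> Ae; have e0 := Anz e Ae.
  pose b i := e ((tperm o0 o1 * tperm o2 o3)%g i) / e i.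
  have Ab : A b by apply: AD => //; apply: At => //; rewrite odd_permM !odd_tperm.
  pose c i := b ((tperm o0 o1 * tperm o0 o4)%g i) / b i.
  have Ac : A c by apply: AD => //; apply: At => //; rewrite odd_permM !odd_tperm.
  pose r i := c ((tperm o2 o3 * tperm o3 o4)%g i) / c i.
  have Ar : A r by apply: AD => //; apply: At => //; rewrite odd_permM !odd_tperm.
  suff -> : delta o2 o4 (e o1 / e o0) = r by [].
  apply/funext; apply: forall5; rewrite /r /c /b !permE /= !permE /= ?permE /= ?permE /=;
    rewrite /delta /=; by field; rewrite ?oner_eq0 ?e0.
(* The base case reads the ratio at 1 and 0 and writes it at 2 and 4. Here [u] sends 1, 0 to [i],
   [j], and [v^-1 * u'] sends [k], [l] to 2, 4. *)
move: ij; rewrite eq_sym => ji; have [u [eu u0 u1]] := even_transitive2 j i ji.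
have [v [ev v0 v1]] := even_transitive2 _ _ kl.
have [u' [eu' u2 u4]] := even_transitive2 o2 o4 isT.
have := At (v^-1 * u')%g _ _ (base _ (At u d eu Ad)).
rewrite odd_permM odd_permV (negbTE ev) (negbTE eu') u0 u1 => /(_ isT).
congr A; apply/funext => a; rewrite /delta permM -{1}u2 -u4 !(inj_eq perm_inj).
by rewrite !(can2_eq (permKV v) (permK v)) v0 v1.
Qed.

End DiagonalGroups.

(** * Automorphisms of the pentagon form *)

Section Extension.
Context {F : fieldType}.
Implicit Types (d e a : 'I_5 -> F) (t u : 'S_5).

Definition cvec (z : F) : 'I_5 -> F := fun i => [:: 1; z; z^-1; z^-1; z]`_i.

Lemma cvecE z : (cvec z o0 = 1) * (cvec z o1 = z) * (cvec z o2 = z^-1)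
  * (cvec z o3 = z^-1) * (cvec z o4 = z).
Proof. by []. Qed.

(* The cyclic pentagon form: [w c_1] and [s] preserve the quadratic form with
   these coefficients off the diagonal when [om] is a cube root of unity. *)
Definition pentagon (om : F) (i j : 'I_5) : F :=
  if (j == sp i) || (i == sp j) then 1 else om.

(** The last condition says that the monomial matrix with entries [d i ^+ q] along [t] is an
    isometry of the quadratic form with coefficients [pentagon om]; [om = 1] gives the form with all
    off-diagonal coefficients 1. *)
Definition form_lift (q : nat) (om : F) d t :=
  [/\ ~~ odd_perm t, \prod_i d i = 1 &
      forall i j, i != j ->
        (d i * d j) ^+ q * pentagon om (t i) (t j) = pentagon om i j].

Variables (q : nat) (om : F).
Hypothesis om3 : om ^+ 3 = 1.

Let om0 : om != 0.
Proof. by apply/eqP => E; move/eqP: om3; rewrite E expr0n eq_sym oner_eq0. Qed.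

Let pentagon0 i j : pentagon om i j != 0.
Proof. by rewrite /pentagon; case: ifP; rewrite ?oner_eq0. Qed.

Lemma form_lift1 : form_lift q om (fun=> 1) 1.
Proof.
split; first by rewrite odd_perm1.
  by rewrite big1.
by move=> i j _; rewrite !perm1 mulr1 expr1n mul1r.
Qed.

Lemma form_liftM d e t u : form_lift q om d t -> form_lift q om e u ->
  form_lift q om (fun i => d i * e (t i)) (t * u).
Proof.
move=> [et pd fd] [eu pe fe]; split.
- by rewrite odd_permM (negbTE et) (negbTE eu).
- by rewrite big_split /= pd mul1r -[RHS]pe [RHS](reindex_inj (@perm_inj _ t)).
- move=> i j ij; rewrite !permM -[RHS]fd // -(fe (t i) (t j)) ?(inj_eq perm_inj) //.
  by rewrite !exprMn; ring.
Qed.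

Lemma form_liftV d t : form_lift q om d t ->
  form_lift q om (fun i => (d (t^-1%g i))^-1) t^-1.
Proof.
move=> [et pd fd]; split; first by rewrite odd_permV.
- by rewrite prodfV; rewrite -[RHS]invr1; congr (_^-1); rewrite -[RHS]pd [RHS](reindex_inj (@perm_inj _ t^-1%g)).
- move=> i j ij; have nd := prod_nowhere0 _ pd.
  have := fd (t^-1%g i) (t^-1%g j); rewrite (inj_eq perm_inj) !permKV => /(_ ij) <-.
  by rewrite mulrA -exprMn -invfM mulVf ?expr1n ?mul1r ?mulf_neq0.
Qed.

(** Let x_i be the q-th power of d_i. Products of two distinct x_i are 1, and so is the product of
    all five; splitting off two disjoint pairs leaves x_4 = 1. *)
Lemma form_lift_diag d : form_lift q om d 1 -> forall i, d i ^+ q = 1.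
Proof.
move=> [_ pd fd].
have E i j : i != j -> d i ^+ q * d j ^+ q = 1.
  move=> ij; apply: (mulIf (pentagon0 i j)); rewrite mul1r -[RHS]fd // !perm1.
  by rewrite exprMn.
have d4 : d o4 ^+ q = 1.
  have := congr1 (fun x => x ^+ q) pd; rewrite prod5 expr1n !exprMn.
  by rewrite E // mul1r E // mul1r.
by apply: forall5; rewrite // -[LHS]mulr1 -d4 E.
Qed.

Lemma form_lift_sp : form_lift q om (fun=> 1) sp.
Proof.
split; first by rewrite even_sp.
  by rewrite big1.
by move=> i j _; rewrite mulr1 expr1n mul1r /pentagon !(inj_eq perm_inj).
Qed.

(** Both sides of each condition are powers of [om]; they agree because om^-2 = om for a cube root
    of unity. *)
Lemma form_lift_wp z : z != 0 -> z ^+ q = om ->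
  form_lift q om (fun i => cvec z (wp i)) wp.
Proof.
move=> z0 zq; split; first by rewrite even_wp.
  by rewrite prod5 !wpE !cvecE; field.
have E : om * (om * om) = 1 by rewrite -[RHS]om3 !exprS expr0 mulr1.
have EV : om^-1 * om^-1 = om by by apply: (mulfI om0); rewrite mulVKf //; apply: (mulfI om0); rewrite mulfV // E.
apply: forall5; apply: forall5 => // _; rewrite /pentagon !wpE !spE !cvecE /=.
all: rewrite ?mul1r ?mulr1 ?exprMn ?exprVn ?zq ?mulVf ?mulfV ?EV //.
all: by rewrite ?mul1r -?mulrA.
Qed.

End Extension.

(** * Groups of monomial matrices *)

Section MatrixGroups.
Context {R : realType}.
Local Notation C := (R[i]).
Local Notation M5 := ('M[C]_5).
Implicit Types (G A S : set M5) (d e : 'I_5 -> C) (t u : 'S_5).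

Lemma mon_unit_nowhere0 d t : mon d t \in unitmx -> nowhere0 d.
Proof.
rewrite unitmxE det_mon unitfE mulf_eq0 negb_or => /andP[_ /prodf_neq0 nd] i.
exact: nd.
Qed.

Lemma DmatP (g : M5) : Dmat g <-> exists2 d, nowhere0 d & g = mon d 1.
Proof.
split=> [[/is_diag_mxP dg ug]|[d nd ->]].
  have E : g = mon (fun i => g i i) 1.
    apply/matrixP => i j; rewrite !mxE perm1.
    by have [<-|ij] := eqVneq i j; rewrite // dg.
  by exists (fun i => g i i) => //; apply: (@mon_unit_nowhere0 _ 1); rewrite -E.
split; last exact: mon_unit.
by rewrite mon_diag diag_mx_is_diag.
Qed.

Lemma MmatP (g : M5) : Mmat g <-> exists d t, nowhere0 d /\ g = mon d t.
Proof.
split=> [[_ [t [/DmatP[d nd ->] ->]]]|[d [t [nd ->]]]].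
  by exists d, t; split=> //; rewrite mon_diag mon_diag_perm.
exists (mon d 1), t; split; first by apply/DmatP; exists d.
by rewrite mon_diag mon_diag_perm.
Qed.

Lemma perm_partP G t : is_subgroup G -> perm_part G t <-> exists d, G (mon d t).
Proof.
move=> [_ _ GV]; split=> [[_ [/DmatP[d nd ->] Gd]]|[d Gd]].
  by exists d; rewrite -mon_diag_perm -mon_diag.
exists (mon d 1); split; last by rewrite mon_diag mon_diag_perm.
by apply/DmatP; exists d => //; apply: (@mon_unit_nowhere0 _ t); have [] := GV _ Gd.
Qed.

Lemma subgroup_nowhere0 G d t : is_subgroup G -> G (mon d t) -> nowhere0 d.
Proof. by move=> [_ _ GV] /GV[/mon_unit_nowhere0]. Qed.

Lemma subgroup_monM G d e t u : is_subgroup G -> G (mon d t) -> G (mon e u) ->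
  G (mon (fun i => d i * e (t i)) (t * u)).
Proof. by move=> [_ GM _] Gd Ge; rewrite -mon_mul; exact: GM. Qed.

Lemma subgroup_monV G d t : is_subgroup G -> G (mon d t) ->
  G (mon (fun i => (d (t^-1%g i))^-1) t^-1).
Proof.
move=> sG Gd; have nd := subgroup_nowhere0 _ _ _ sG Gd.
by rewrite -mon_invr //; have [_ _ /(_ _ Gd)[]] := sG.
Qed.

Lemma subgroup_exp G g k : is_subgroup G -> G g -> G (g ^+ k).
Proof.
move=> [G1 GM _] Gg; elim: k => [|k IH]; first by rewrite expr0.
by rewrite exprS; exact: GM.
Qed.

Definition dset A : ('I_5 -> C) -> Prop := fun d => A (mon d 1).

Lemma dset_group A : is_subgroup A -> diag_group (dset A).
Proof.
move=> sA; split; rewrite /dset.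
- by rewrite mon1; case: sA.
- move=> d e Ad Ae; have := subgroup_monM _ _ _ _ _ sA Ad Ae.
  by rewrite mulg1; congr A; congr mon; apply/funext => i; rewrite perm1.
- move=> d Ad; have := subgroup_monV _ _ _ sA Ad.
  by rewrite invg1; congr A; congr mon; apply/funext => i; rewrite perm1.
- by move=> d; apply: subgroup_nowhere0.
Qed.

Lemma subset_Dmat_mon A a : A `<=` Dmat (R := R) -> A a ->
  exists2 d, dset A d & a = mon d 1.
Proof. by move=> AD Aa; have /DmatP[d nd E] := AD _ Aa; exists d; rewrite // /dset -E. Qed.

Lemma sym_inv_comp A d t : sym_inv_diag A -> dset A d -> dset A (fun i => d (t i)).
Proof.
move=> [_ _ _ At] /(At t^-1%g); rewrite -!mon_perm mon_conj => [|i]; last exact: oner_neq0.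
rewrite conj1g invgK /dset; congr A; congr mon.
by apply/funext => i; rewrite invr1 mul1r mulr1.
Qed.

Lemma gen_subset S G : is_subgroup G -> S `<=` G -> gen S `<=` G.
Proof. by move=> sG SG g; apply. Qed.

Lemma gen_subgroup S : S `<=` [set g | g \in unitmx] -> is_subgroup (gen S).
Proof.
move=> SU; split=> [H [] //|g h Gg Gh H sH SH|g Gg].
  by case: (sH) => _ HM _; apply: HM; [apply: Gg | apply: Gh].
split; last by move=> H sH SH; have [_ _ HV] := sH; have [] := HV g (Gg H sH SH).
apply: (Gg [set g | g \in unitmx]) => //; split=> /= [|x y ux uy|x ux].
- exact: unitmx1.
- by rewrite unitmx_mul ux.
- by rewrite unitmx_inv.
Qed.

Section PermGroup.
Variable G : set M5.
Hypothesis sG : is_subgroup G.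

(** Classical decidability makes the permutation part a finite set, to which the theory of subgroups
    of the symmetric group applies. *)
Definition perm_group : {set 'S_5} := [set t | `[< exists d, G (mon d t) >]].

Lemma perm_groupP t : reflect (exists d, G (mon d t)) (t \in perm_group).
Proof. by rewrite inE; exact: asboolP. Qed.

Lemma perm_group_set : group_set perm_group.
Proof.
apply/group_setP; split=> [|t u /perm_groupP[d Gd] /perm_groupP[e Ge]].
  by apply/perm_groupP; exists (fun=> 1); rewrite mon1; case: sG.
by apply/perm_groupP; eexists; apply: subgroup_monM Gd Ge.
Qed.

Lemma even_lift d e : G (mon d sp) -> G (mon e wp) ->
  forall t, ~~ odd_perm t -> exists e, G (mon e t).
Proof.
move=> Gs Gw t et; apply/perm_groupP.
by apply: (@Alt5_sub (Group perm_group_set)) et; apply/perm_groupP; [exists d | exists e].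
Qed.

(** [G] is a union of finitely many cosets of its diagonal part, one for each permutation with a
    lift in [G]. *)
Lemma finite_monomial : G `<=` Mmat (R := R) -> finite_set (G `&` Dmat (R := R)) ->
  finite_set G.
Proof.
move=> GM fA.
(* Over a permutation without a lift, the default identity matrix merely repeats the diagonal
   part. *)
pose lift t := xget (1%:M : M5) [set g | exists d, g = mon d t /\ G g].
have -> : G = \bigcup_(t in [set: 'S_5])
    ([set a *m lift t | a in G `&` Dmat (R := R)] `&` G).
  apply/seteqP; split=> [g Gg|g [t _ []] //]; have /MmatP[d [t [nd E]]] := GM _ Gg.
  exists t => //; split=> //.
  have [e [El Gl]] : exists e, lift t = mon e t /\ G (lift t).
    by apply: (@xgetPex _ (1%:M : M5) [set g | exists d, g = mon d t /\ G g]); exists g, d; rewrite -E.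
  have ne : nowhere0 e by apply: (@subgroup_nowhere0 G _ t); rewrite // -El.
  have ul : lift t \in unitmx by rewrite El mon_unit.
  exists (g *m invmx (lift t)); last by rewrite mulmxKV.
  split; first by case: sG => _ GM' GV; apply: GM' => //; have [] := GV _ Gl.
  rewrite E El mon_invr // mon_mul mulgV; apply/DmatP; eexists; last by [].
  by apply: nowhere0_mul => // i; rewrite permK invr_eq0.
apply: bigcup_finite => [|t _]; first exact: finite_finset.
by apply: finite_setIl; apply: finite_image.
Qed.

End PermGroup.
End MatrixGroups.

(** * The groups generated by s, w c and A *)

Section Extensions.
Context {R : realType}.
Local Notation C := (R[i]).
Local Notation M5 := ('M[C]_5).
Implicit Types (d e : 'I_5 -> C) (t u : 'S_5).

(** Treats both families at once: [z = 1] gives the generators s, w and [z = eps n.+1] gives s, w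
    c_{n+1}. *)
Definition ext (z : C) (A : set M5) : set M5 :=
  gen ([set smat R; wmat R *m mon (cvec z) 1] `|` A).

Lemma wmat_cvec z : wmat R *m mon (cvec z) 1 = mon (fun i => cvec z (wp i)) wp.
Proof. by rewrite wmatE mon_mul mulg1; congr mon; apply/funext => i; rewrite mul1r. Qed.

Lemma cvec_nowhere0 (z : C) : z != 0 -> nowhere0 (cvec z).
Proof. by move=> z0; apply: forall5; rewrite !cvecE ?invr_eq0 ?oner_eq0. Qed.

Variables (A : set M5) (z : C).
Hypotheses (symA : sym_inv_diag A) (z0 : z != 0).
Local Notation G := (ext z A).

Lemma ext_subgroup : is_subgroup G.
Proof.
have [_ _ AD _] := symA.
rewrite /ext; apply: gen_subgroup => g [[->|->]|/AD[] //] /=.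
  by rewrite smatE mon_unit // => i; rewrite oner_eq0.
by rewrite wmat_cvec mon_unit //; apply: nowhere0_comp; apply: cvec_nowhere0.
Qed.

Lemma ext_sp : G (mon (fun=> 1) sp).
Proof. by move=> H _; apply; left; left; rewrite smatE. Qed.

Lemma ext_wp : G (mon (fun i => cvec z (wp i)) wp).
Proof. by move=> H _; apply; left; right; rewrite wmat_cvec. Qed.

Lemma sub_ext : A `<=` G.
Proof. by move=> a Aa; move=> H _; apply; right. Qed.

Variable q : nat.
Hypotheses (z3 : (z ^+ q) ^+ 3 = 1)
  (Aq : forall d, \prod_i d i = 1 -> (forall i, d i ^+ q = 1) -> dset A d).

(** Such products form a subgroup containing the generators: the symmetry of [A] lets its elements
    pass through permutations, and form-preserving factors compose. *)
Lemma ext_form g : G g ->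
  exists a d t, [/\ dset A a, form_lift q (z ^+ q) d t & g = mon (fun i => a i * d i) t].
Proof.
have [sA _ AD _] := symA; have [A1 AM AV _] := dset_group _ sA.
move=> Gg; pose S' := [set g : M5 | exists a d t,
  [/\ dset A a, form_lift q (z ^+ q) d t & g = mon (fun i => a i * d i) t]].
apply: (Gg S') => [|h [[->|->]|Ah]].
- have nz a d t : dset A a -> form_lift q (z ^+ q) d t -> nowhere0 (fun i => a i * d i).
    move=> Aa [_ pd _]; apply: nowhere0_mul; last exact: prod_nowhere0.
    exact: subgroup_nowhere0 Aa.
  split.
  + exists (fun=> 1), (fun=> 1), 1%g; split=> //; first exact: form_lift1.
    by rewrite -mon1; congr mon; apply/funext => i; rewrite mulr1.
  + move=> _ _ [a [d [t [Aa fd ->]]]] [b [e [u [Ab fe ->]]]].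
    exists (fun i => a i * b (t i)), (fun i => d i * e (t i)), (t * u)%g; split.
    * by apply: AM => //; apply: sym_inv_comp.
    * exact: form_liftM.
    * by rewrite mon_mul; congr mon; apply/funext => i; ring.
  + move=> _ [a [d [t [Aa fd ->]]]]; split; first by apply: mon_unit; apply: nz Aa fd.
    exists (fun i => (a (t^-1%g i))^-1), (fun i => (d (t^-1%g i))^-1), t^-1%g; split.
    * by apply: (AV (fun i => a (t^-1%g i))); apply: sym_inv_comp.
    * exact: form_liftV.
    * by rewrite mon_invr; [congr mon; apply/funext => i; rewrite invfM | apply: nz Aa fd].
- exists (fun=> 1), (fun=> 1), sp; split=> //; first exact: form_lift_sp.
  by rewrite smatE; congr mon; apply/funext => i; rewrite mulr1.
- exists (fun=> 1), (fun i => cvec z (wp i)), wp; split=> //; first exact: form_lift_wp.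
  by rewrite wmat_cvec; congr mon; apply/funext => i; rewrite mul1r.
- have [d Ad ->] := subset_Dmat_mon _ _ AD Ah.
  exists d, (fun=> 1), 1%g; split=> //; first exact: form_lift1.
  by congr mon; apply/funext => i; rewrite mulr1.
Qed.

(** Over the identity permutation the form-preserving factor has determinant 1 and entries with q-th
    power 1, so [Aq] puts it in [A]. *)
Lemma ext_diag d : G (mon d 1) -> dset A d.
Proof.
move=> Gd; have nd := subgroup_nowhere0 _ _ _ ext_subgroup Gd.
have [a [e [t [Aa fe E]]]] := ext_form _ Gd.
have [t1 Ed] := mon_inj nd E; rewrite -t1 in fe.
have [sA _ _ _] := symA; have [_ AM _ _] := dset_group _ sA.
rewrite Ed; apply: AM => //; apply: Aq; first by case: fe.
exact: form_lift_diag fe.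
Qed.

Lemma ext_Mmat : G `<=` Mmat (R := R).
Proof.
move=> g Gg; have [a [d [t [_ _ E]]]] := ext_form _ Gg.
apply/MmatP; exists (fun i => a i * d i), t; split=> //.
by apply: (@subgroup_nowhere0 _ _ _ t ext_subgroup); rewrite -E.
Qed.

Lemma ext_Dmat : G `&` Dmat (R := R) = A.
Proof.
have [_ _ AD _] := symA; apply/seteqP; split=> [g [Gg /DmatP[d _ E]]|a Aa].
  by rewrite E in Gg *; apply: ext_diag.
by split; [apply: sub_ext | apply: AD].
Qed.

Lemma ext_finite : finite_subgroup_M G.
Proof.
split; [exact: ext_subgroup | | exact: ext_Mmat].
apply: finite_monomial => //; [exact: ext_subgroup | exact: ext_Mmat | ].
by rewrite ext_Dmat; case: symA.
Qed.

Lemma ext_perm_part : perm_part G = [set t | t \in Alt 'I_5].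
Proof.
apply/seteqP; split=> t /=; rewrite mem_Alt5.
  move/(perm_partP _ _ ext_subgroup) => [d Gd].
  have [a [e [u [_ [eu _ _] E]]]] := ext_form _ Gd.
  by have [-> _] := mon_inj (subgroup_nowhere0 _ _ _ ext_subgroup Gd) E.
move=> et; apply/(perm_partP _ _ ext_subgroup).
exact: even_lift ext_subgroup _ _ ext_sp ext_wp _ et.
Qed.

End Extensions.

(** For [z = 1] and [q = 1] all coefficients of the form are 1, so the condition on [d] does not see
    the permutation: [d] is a diagonal isometry, hence trivial. *)
Lemma ext1_form {R : realType} A (g : 'M[R[i]]_5) : sym_inv_diag A -> ext 1 A g ->
  exists a (t : 'S_5), [/\ dset A a, ~~ odd_perm t & g = mon a t].
Proof.
move=> symA Gg; have z3 : ((1 : R[i]) ^+ 1) ^+ 3 = 1 by rewrite !expr1n.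
have [a [d [t [Aa fd ->]]]] := ext_form _ 1 symA (oner_neq0 _) 1 z3 _ Gg.
exists a, t; split=> //; first by case: fd.
congr mon; apply/funext => i; suff -> : d i = 1 by rewrite mulr1.
rewrite -[LHS]expr1; apply: (form_lift_diag _ _ z3).
have [et pd fd'] := fd; split=> //; first by rewrite odd_perm1.
by move=> j k jk; have := fd' j k jk; rewrite expr1n /pentagon; do !case: ifP.
Qed.

(** * Irreducibility criteria *)

Lemma tpE {T : finType} (x y z : T) :
  tperm x y z = if z == x then y else if z == y then x else z.
Proof. by rewrite permE. Qed.

(* [v] and its conjugates by [w] are commuting involutions acting regularly on the first
   four coordinates; the projection onto their fixed vectors followed by [w - z^2] only
   leaves the last coordinate. *)
Lemma unit4_combination {F : fieldType} (z : F) : z ^+ 3 = 1 ->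
  let w := mon (fun i => cvec z (wp i)) wp in let s := mon (fun=> 1) sp in
  let s' := mon (fun i => 1^-1) sp^-1 in
  let v := w *m s' *m w *m s in let v' := w *m w *m v *m w in
  (4 * (z - z ^+ 2)) *: delta_mx o4 o4 = (1%:M + v) *m (1%:M + v') *m (w - (z ^+ 2)%:M).
Proof.
move=> z3 w s s' v v'.
have z0 : z != 0 by apply/eqP => E; move/eqP: z3; rewrite E expr0n eq_sym oner_eq0.
have zV : z^-1 = z ^+ 2 by apply: (mulfI z0); rewrite mulfV // -exprS.
have z4 : z ^+ 2 * z ^+ 2 = z by rewrite -exprD exprS z3 mulr1.
have zz2 : z * z ^+ 2 = 1 by rewrite -exprS.
have z2z : z ^+ 2 * z = 1 by rewrite -exprSr.
have zz : z * z = z ^+ 2 by [].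
pose zE := (z4, zz2, z2z, zz, mul1r, mulr1, add0r, addr0, mulr0).
have wE : w = mon (fun i => [:: z; z ^+ 2; 1; z ^+ 2; z]`_i) wp.
  by congr mon; apply/funext; apply: forall5; rewrite wpE ?cvecE ?zV.
have vE : v = mon (fun i => [:: z ^+ 2; z; z; z ^+ 2; 1]`_i) (tperm o0 o2 * tperm o1 o3)%g.
  rewrite /v wE /s /s' !mon_mul; congr mon.
    by apply/funext; apply: forall5; rewrite !permM ?wpE ?spVE ?wpE ?spVE ?invr1 /= ?zE.
  by apply/permP; apply: forall5; rewrite !permM ?wpE ?spVE ?wpE ?spE !tpE.
have v'E : v' = mon (fun i => [:: z ^+ 2; z; z; z ^+ 2; 1]`_i) (tperm o0 o1 * tperm o2 o3)%g.
  rewrite /v' vE wE !mon_mul; congr mon.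
    by apply/funext; apply: forall5; rewrite !permM !wpE !tpE /= ?wpE /= ?zE.
  by apply/permP; apply: forall5; rewrite !permM !wpE !tpE /= ?wpE.
have vv'E : v *m v' = mon (fun=> 1) (tperm o0 o3 * tperm o1 o2)%g.
  rewrite vE v'E !mon_mul; congr mon.
    by apply/funext; apply: forall5; rewrite !permM !tpE /= ?zE.
  by apply/permP; apply: forall5; rewrite !permM !tpE.
rewrite mulmxDl mul1mx mulmxDr mulmx1 vv'E vE v'E wE mulmxBr mul_mx_scalar.
rewrite !mulmxDl !mon_mul mul1mx.
apply/matrixP; apply: forall5; apply: forall5;
  rewrite !mxE ?perm1 !permM ?wpE !tpE /= ?wpE /= ?mulr0n ?mulr1n ?zE ?subrr ?oppr0 //.
ring.
Qed.

Lemma stable_unit4 {F : fieldType} (z : F) (U : 'M[F]_5) : z ^+ 3 = 1 ->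
  stablemx U (mon (fun i => cvec z (wp i)) wp) -> stablemx U (mon (fun=> 1) sp) ->
  stablemx U (mon (fun=> 1^-1) sp^-1) -> stablemx U ((4 * (z - z ^+ 2)) *: delta_mx o4 o4).
Proof.
move=> z3; have := unit4_combination z z3; cbv zeta.
set w := mon _ wp; set s := mon _ sp; set s' := mon _ sp^-1%g => -> Uw Us Us'.
have Uv := stablemxM (stablemxM (stablemxM Uw Us') Uw) Us.
have Uv' := stablemxM (stablemxM (stablemxM Uw Uw) Uv) Uw.
apply: stablemxM; last by rewrite stablemxD ?stablemxN ?stablemxC.
by apply: stablemxM; rewrite stablemxD ?stablemxC.
Qed.

Section Irreducibility.
Context {R : realType}.
Local Notation C := (R[i]).
Local Notation M5 := ('M[C]_5).
Implicit Types (d e : 'I_5 -> C) (G : set M5).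

(** If the last coordinate vanishes on [U], the lift of the 5-cycle carries this to every coordinate
    and U = 0. Otherwise the matrix unit puts the last basis vector in [U], and the lift of the
    5-cycle then produces the other four up to scalars. *)
Lemma irreducible_of_unit4 G d (c : C) : is_subgroup G -> G (mon d sp) -> c != 0 ->
  (forall U : M5, (forall g, G g -> stablemx U g) -> stablemx U (c *: delta_mx o4 o4)) ->
  irreducible G.
Proof.
move=> sG Gs c0 H U GU; have Uc := H U GU; have nd := subgroup_nowhere0 _ _ _ sG Gs.
have Us := GU _ Gs.
have vanish j k : sp j = k -> (forall v : 'rV_5, (v <= U)%MS -> v 0 k = 0) ->
    forall v : 'rV_5, (v <= U)%MS -> v 0 j = 0.
  move=> <- V v vU; have : (v *m mon d sp) 0 (sp j) = 0.
    by apply: V; apply: submx_trans Us; apply: submxMr.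
  rewrite mxE (bigD1 j) //= mxE eqxx big1 => [|l lj]; last first.
    by rewrite mxE (inj_eq perm_inj) (negbTE lj) mulr0.
  by rewrite addr0 => /eqP; rewrite mulf_eq0 (negbTE (nd j)) orbF => /eqP.
have unit_step j : ((delta_mx 0 j : 'rV[C]_5) <= U)%MS ->
    ((delta_mx 0 (sp j) : 'rV[C]_5) <= U)%MS.
  move=> jU; rewrite -[delta_mx _ _](scalerK (nd j)) scalemx_sub // -mon_row rowE.
  by apply: submx_trans Us; apply: submxMr.
have [V|/existsNP[v /not_implyP[vU v4]]] :=
    pselect (forall v : 'rV_5, (v <= U)%MS -> v 0 o4 = 0).
  left; apply/eqP; rewrite mxrank_eq0; apply/eqP/matrixP => i j.
  have V3 := vanish o3 _ ltac:(by rewrite spE) V; have V2 := vanish o2 _ ltac:(by rewrite spE) V3.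
  have V1 := vanish o1 _ ltac:(by rewrite spE) V2; have V0 := vanish o0 _ ltac:(by rewrite spE) V1.
  have : forall v : 'rV_5, (v <= U)%MS -> v 0 j = 0 by move: j; apply: forall5.
  by move/(_ _ (row_sub i U)); rewrite !mxE.
right; apply/eqP; rewrite eqn_leq rank_leq_row -{1}(mxrank1 C 5) mxrankS //.
have U4 : ((delta_mx 0 o4 : 'rV[C]_5) <= U)%MS.
  have nz : c * v 0 o4 != 0 by rewrite mulf_neq0 //; apply/eqP.
  rewrite -[delta_mx _ _](scalerK nz) scalemx_sub //.
  have -> : c * v 0 o4 *: delta_mx 0 o4 = v *m (c *: delta_mx o4 o4).
    apply/rowP => j; rewrite !mxE (bigD1 o4) //= !mxE big1 => [|k kj]; last first.
      by rewrite !mxE (negbTE kj) /= !mulr0.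
    by rewrite !eqxx addr0 /= mulrCA mulrA.
  by apply: submx_trans Uc; apply: submxMr.
apply/row_subP => i; rewrite row1.
have U0 := unit_step _ U4; have U1 := unit_step _ U0; have U2 := unit_step _ U1.
have U3 := unit_step _ U2; move: U0 U1 U2 U3; rewrite !spE.
by move: i; apply: forall5.
Qed.

(** The two diagonal matrices differ from 1 at a common position only at 4, so the product of their
    differences from 1 is a multiple of the matrix unit there. *)
Lemma irreducible_delta G d (x : C) : is_subgroup G -> G (mon d sp) -> x != 0 -> x != 1 ->
  G (mon (delta o4 o0 x) 1) -> G (mon (delta o4 o1 x) 1) -> irreducible G.
Proof.
move=> sG Gs x0 x1 G0 G1; apply: (irreducible_of_unit4 _ _ ((x - 1) ^+ 2) sG Gs).
  by rewrite expf_neq0 // subr_eq0.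
move=> U GU.
have -> : (x - 1) ^+ 2 *: delta_mx o4 o4 =
    (mon (delta o4 o0 x) 1 - 1%:M) *m (mon (delta o4 o1 x) 1 - 1%:M).
  rewrite mulmxBl mulmxBr !mul1mx mulmx1 mon_mul mulg1.
  apply/matrixP; apply: forall5; apply: forall5; rewrite !mxE ?perm1 /delta /=; ring.
by rewrite stablemxM // stablemxD ?stablemxN ?stablemxC ?GU.
Qed.

(** Handles scalar [A], where no nontrivial [delta] is available and the matrix unit must come from
    s and w c_1. *)
Lemma irreducible_cube_root G (z : C) : is_subgroup G -> z ^+ 3 = 1 -> z != 1 ->
  G (mon (fun=> 1) sp) -> G (mon (fun i => cvec z (wp i)) wp) -> irreducible G.
Proof.
move=> sG z3 z1 Gs Gw; have GsV := subgroup_monV _ _ _ sG Gs.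
have z0 : z != 0 by apply/eqP => E; move/eqP: z3; rewrite E expr0n eq_sym oner_eq0.
apply: (irreducible_of_unit4 _ _ (4 * (z - z ^+ 2)) sG Gs).
  by rewrite mulf_neq0 ?pnatr_eq0 // -[X in X - _]mulr1 -mulrBr mulf_neq0 // subr_eq0 eq_sym.
by move=> U GU; apply: stable_unit4 => //; exact: GU.
Qed.

End Irreducibility.

(** * The groups of U *)

Section RootsOfUnity.
Context {R : realType}.
Local Notation C := (R[i]).

(** De Moivre's formula, from the addition formulas. *)
Lemma epsX n k : eps R n ^+ k =
  Complex (cos (k%:R * (2 * pi / (3 ^ n)%N%:R))) (sin (k%:R * (2 * pi / (3 ^ n)%N%:R))).
Proof.
elim: k => [|k IH]; first by rewrite expr0 !mul0r cos0 sin0.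
rewrite exprS IH /eps -[k.+1%:R]natr1; set t := _ / _; rewrite mulrDl mul1r cosD sinD; apply/eqP.
by rewrite eq_complex /=; apply/andP; split; apply/eqP; ring.
Qed.

Lemma eps_exp3 n k : (k <= n)%N -> eps R n ^+ (3 ^ k) = eps R (n - k).
Proof.
move=> kn; rewrite epsX /eps; set x := _ * _; set y := _ / _; suff -> : x = y by [].
rewrite /x /y -{1}(subnK kn) expnD natrM.
by field; rewrite !pnatr_eq0 -!lt0n !expn_gt0.
Qed.

Lemma eps0 : eps R 0 = 1.
Proof. by rewrite /eps expn0 divr1 mulr_natl cos2pi mulr2n sinD sinpi mul0r mulr0 addr0. Qed.

Lemma eps_pow1 n k : (n <= k)%N -> eps R n ^+ (3 ^ k) = 1.
Proof. by move=> nk; rewrite -(subnKC nk) expnD exprM eps_exp3 // subnn eps0 expr1n. Qed.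

(** The imaginary part is the sine of an angle strictly between 0 and [pi]. *)
Lemma eps1_neq1 : eps R 1 != 1.
Proof.
rewrite eq_complex /= negb_and; apply/orP; right.
have p0 := pi_gt0 R.
apply: lt0r_neq0; apply: sin_gt0_pi; rewrite expn1 divr_gt0 ?mulr_gt0 //=.
by rewrite ltr_pdivrMr // mulrC ltr_pM2l // ltr_nat.
Qed.

Lemma epsS_pow n : eps R n.+1 ^+ (3 ^ n) = eps R 1.
Proof. by rewrite eps_exp3 // subSnn. Qed.

Lemma eps_neq0 n : eps R n != 0.
Proof.
apply/eqP => E; have /eqP := eps_pow1 n n (leqnn n).
by rewrite E expr0n expn_eq0 /= eq_sym oner_eq0.
Qed.

Lemma eps1_cube : eps R 1 ^+ 3 = 1.
Proof. exact: (eps_pow1 1 1). Qed.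

Lemma cmatE n : cmat R n = mon (cvec (eps R n)) 1.
Proof. by rewrite mon_diag. Qed.

Lemma Xgrp_mon (d : 'I_5 -> C) : Xgrp (mon d 1) <-> \prod_i d i = 1.
Proof.
rewrite /Xgrp /= det_mon odd_perm1 expr0 mul1r; split=> [[]//|pd]; split=> //.
by apply/DmatP; exists d => //; exact: prod_nowhere0.
Qed.

Lemma mon_exp1 (d : 'I_5 -> C) k : mon d 1 ^+ k = 1 <-> forall i, d i ^+ k = 1.
Proof.
rewrite mon_exp; split=> [E i|E].
  by have /matrixP/(_ i i) := E; rewrite !mxE perm1 eqxx.
by rewrite -[RHS](@mon1 C 5); congr mon; apply/funext.
Qed.

Lemma Omega_mon n (d : 'I_5 -> C) :
  Omega n (mon d 1) <-> \prod_i d i = 1 /\ forall i, d i ^+ (3 ^ n) = 1.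
Proof.
split=> [[[/Xgrp_mon pd _] /mon_exp1 dn]//|[pd dn]].
by split; [split; [apply/Xgrp_mon | exists n; apply/mon_exp1] | apply/mon_exp1].
Qed.

Lemma delta_exp k l (x : C) n i : x ^+ n = 1 -> delta k l x i ^+ n = 1.
Proof. by move=> xn; rewrite /delta; do 2?case: ifP; rewrite ?exprVn ?xn ?invr1 ?expr1n. Qed.

Lemma Omega_delta n k l (x : C) : k != l -> x ^+ (3 ^ n) = 1 -> Omega n (mon (delta k l x) 1).
Proof.
move=> kl xn; apply/Omega_mon; split; last by move=> i; exact: delta_exp.
apply: prod_delta => //; apply/eqP => x0; move/eqP: xn.
by rewrite x0 expr0n expn_eq0 /= eq_sym oner_eq0.
Qed.

End RootsOfUnity.

Section StructureOfU.
Context {R : realType}.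
Local Notation C := (R[i]).
Local Notation M5 := ('M[C]_5).
Implicit Types (G H A : set M5) (d e : 'I_5 -> C).

Lemma scalar_mon d : is_scalar_mx (mon d 1) <-> forall i j, d i = d j.
Proof.
split=> [/is_scalar_mxP[x E] i j|E].
  by have /matrixP E' := E; have := E' i i; have := E' j j; rewrite !mxE !perm1 !eqxx !mulr1n => -> ->.
apply/is_scalar_mxP; exists (d o0); apply/matrixP => i j; rewrite !mxE perm1.
by rewrite (E o0 i).
Qed.

Lemma nonscalar_delta A : is_subgroup A -> A `<=` Dmat (R := R) -> even_inv (dset A) ->
  ~ A `<=` scalars (R := R) ->
  exists x : C, [/\ x != 0, x != 1 & forall k l, k != l -> dset A (delta k l x)].
Proof.
move=> sA AD At /existsNP[a /not_implyP[Aa]].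
have [d Ad ->] := subset_Dmat_mon _ _ AD Aa; move=> ns.
have nd := subgroup_nowhere0 _ _ _ sA Ad.
have [i [j dij]] : exists i j, d i != d j.
  apply: contrapT => H; apply: ns; apply/scalar_mon => i j; apply/eqP.
  by apply: contrapT => /negP E; apply: H; exists i, j.
exists (d i / d j); split; first by rewrite mulf_neq0 ?invr_eq0.
  by rewrite -(inj_eq (mulIf (nd j))) mulfVK // mul1r.
move=> k l kl; apply: ratio_delta => //; first exact: dset_group.
by apply: contra_neq dij => ->.
Qed.

Lemma sym_even A : sym_inv_diag A -> even_inv (dset A).
Proof. by move=> sA t d _; exact: sym_inv_comp. Qed.

(** The pair [z], [q] is 1, 1 in the first family and [eps n.+1], [3 ^ n] in the second, so that
    [z ^+ q] is 1 or a primitive cube root of unity. *)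
Definition ext_data A z q (G : set M5) :=
  [/\ sym_inv_diag A, G = ext z A, z != 0, (z ^+ q) ^+ 3 = 1 &
      forall d, \prod_i d i = 1 -> (forall i, d i ^+ q = 1) -> dset A d].

Lemma ext1 A : ext 1 A = gen ([set smat R; wmat R] `|` A).
Proof.
rewrite /ext; congr (gen ([set _; _] `|` _)).
rewrite -[RHS]mulmx1 -[1%:M]mon1; congr (_ *m mon _ _).
by apply/funext; apply: forall5; rewrite cvecE ?invr1.
Qed.

Lemma inU_ext G : inU G ->
  (exists A, ext_data A 1 1 G /\ ~ A `<=` scalars (R := R)) \/
  (exists n A, ext_data A (eps R n.+1) (3 ^ n) G /\ A `&` X3 (R := R) = Omega n).
Proof.
case=> [[A [symA nsA ->]]|[n [A [symA An ->]]]]; [left; exists A|right; exists n, A].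
  split=> //; split=> //; rewrite ?ext1 ?oner_neq0 ?expr1n //.
  move=> d _ d1; have [sA _ _ _] := symA; have [A1 _ _ _] := dset_group _ sA.
  by suff -> : d = (fun=> 1) by []; apply/funext => i; rewrite -[LHS]expr1.
split=> //; split=> //; rewrite ?eps_neq0 ?epsS_pow ?eps1_cube ?cmatE //.
move=> d pd dn; have : Omega n (mon d 1) by apply/Omega_mon.
by rewrite -An => -[].
Qed.

Lemma inU_properties G : inU G ->
  [/\ finite_subgroup_M G, irreducible G & perm_part G = [set t | t \in Alt 'I_5]].
Proof.
have ns A z q : ext_data A z q G -> ~ A `<=` scalars (R := R) -> irreducible G.
  move=> [symA EG z0 _ _] nsA; have [sA _ AD _] := symA.
  have [x [x0 x1 Ax]] := nonscalar_delta _ sA AD (sym_even _ symA) nsA.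
  have sG := ext_subgroup _ _ symA z0; rewrite EG.
  apply: (irreducible_delta _ _ x sG (ext_sp _ _) x0 x1); apply: sub_ext; exact: Ax.
have fp A z q : ext_data A z q G ->
    finite_subgroup_M G /\ perm_part G = [set t | t \in Alt 'I_5].
  move=> [symA EG z0 z3 Aq]; rewrite EG.
  by split; [exact: (ext_finite _ _ symA z0 _ z3) | exact: (ext_perm_part _ _ symA z0 _ z3)].
case/inU_ext=> [[A [DG nsA]]|[n [A [DG An]]]].
  by have [? ?] := fp _ _ _ DG; split=> //; exact: (ns _ _ _ DG).
have [? ?] := fp _ _ _ DG; split=> //.
have [scA|] := pselect (A `<=` scalars (R := R)); last exact: (ns _ _ _ DG).
(* For positive [n] the group [Omega n] contains a nonscalar [delta] with entry [eps 1]; hence a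
   scalar [A] leaves only [z = eps 1]. *)
have n0 : n = 0%N.
  case: n An {DG} => // n An.
  have : Omega n.+1 (mon (delta o0 o1 (eps R 1)) 1) by apply: Omega_delta; rewrite ?eps_pow1.
  rewrite -An => -[/scA /scalar_mon/(_ o0 o2)]; rewrite /delta /= => E.
  by have := @eps1_neq1 R; rewrite E eqxx.
have [symA -> z0 _ _] := DG; rewrite n0 in z0 *.
apply: (irreducible_cube_root _ (eps R 1) (ext_subgroup _ _ symA z0)).
- exact: eps1_cube.
- exact: eps1_neq1.
- exact: ext_sp.
- exact: ext_wp.
Qed.

End StructureOfU.

(** * Uniqueness *)

Section Uniqueness.
Context {R : realType}.
Local Notation C := (R[i]).
Local Notation M5 := ('M[C]_5).
Implicit Types (G H A : set M5) (d e : 'I_5 -> C) (P : M5).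

Definition mconj P : M5 -> M5 := fun g => invmx P *m g *m P.

Lemma mconjM P g h : P \in unitmx -> mconj P (g *m h) = mconj P g *m mconj P h.
Proof. by move=> uP; rewrite /mconj !mulmxA mulmxK // . Qed.

Lemma mconjVK P g : P \in unitmx -> mconj (invmx P) (mconj P g) = g.
Proof. by move=> uP; rewrite /mconj invmxK !mulmxA mulmxV // mul1mx mulmxK. Qed.

Lemma mconjK P g : P \in unitmx -> mconj P (mconj (invmx P) g) = g.
Proof. by move=> uP; rewrite -{1}[P]invmxK mconjVK // unitmx_inv. Qed.

Lemma mconjV P g : P \in unitmx -> g \in unitmx -> mconj P (invmx g) = invmx (mconj P g).
Proof.
move=> uP ug; have u : mconj P g \in unitmx by rewrite !unitmx_mul unitmx_inv uP ug.
apply: (can_inj (mulKmx u)); rewrite mulmxV // -mconjM // mulmxV // /mconj mulmx1.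
by rewrite mulVmx.
Qed.

Lemma GLconj_sym G H : GLconj G H -> GLconj H G.
Proof.
move=> [P [uP ->]]; exists (invmx P); split; first by rewrite unitmx_inv.
apply/seteqP; split=> [g Gg|_ [_ [g Gg <-] <-]].
  by exists (mconj P g); [exists g | exact: mconjVK].
by rewrite -[X in G X]/(mconj (invmx P) (mconj P g)) mconjVK.
Qed.

(* The permutations underlying the conjugate of [A] form an abelian normal subgroup of
   the simple group [Alt 5], so they are trivial. *)
Lemma mconj_diag A A' z z' q q' G H P :
  ext_data A z q G -> ext_data A' z' q' H -> P \in unitmx -> H = mconj P @` G ->
  forall a, A a -> A' (mconj P a).
Proof.
move=> [symA EG z0 z3 Aq] [symA' EH z0' z3' Aq'] uP HP.
have sG := ext_subgroup _ _ symA z0; have sH := ext_subgroup _ _ symA' z0'.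
have sAG := @sub_ext _ A z; rewrite -EG in sG sAG; rewrite -EH in sH.
have HM g : H g -> exists d (t : 'S_5), [/\ ~~ odd_perm t, nowhere0 d & g = mon d t].
  rewrite EH => Hg; have [a [d [t [_ [et _ _] E]]]] := ext_form _ _ symA' z0' _ z3' _ Hg.
  exists (fun i => a i * d i), t; split=> //.
  by apply: (@subgroup_nowhere0 _ _ _ t sH); rewrite -E EH.
have [sA _ AD _] := symA; have [A1 AM AV] := sA.
have HA a : A a -> H (mconj P a) by move=> /sAG Ga; rewrite HP; exists a.
have Aunit a : A a -> a \in unitmx by case/AV.
(* [A] is normal in [G], since conjugating by a monomial matrix only permutes diagonal entries. *)
have Anorm g a : G g -> A a -> A (mconj g a).
  rewrite EG => Gg Aa; have [b [e [t [_ _ E]]]] := ext_form _ _ symA z0 _ z3 _ Gg.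
  have [d Ad ->] := subset_Dmat_mon _ _ AD Aa.
  have ne : nowhere0 (fun i => b i * e i).
    by apply: (@subgroup_nowhere0 _ _ _ t sG); rewrite -E EG.
  rewrite /mconj E mon_conj // conj1g.
  rewrite (_ : (fun _ => _) = (fun i => d (t^-1%g i))); first exact: (sym_inv_comp _ _ t^-1%g symA Ad).
  by apply/funext => i; rewrite perm1 mulrAC mulVf ?mul1r.
pose T := [set t : 'S_5 | `[< exists a d, A a /\ mconj P a = mon d t >]]%SET.
have TP t : reflect (exists a d, A a /\ mconj P a = mon d t) (t \in T).
  by rewrite inE; exact: asboolP.
have gT : group_set T.
  apply/group_setP; split=> [|t u /TP[a [d [Aa Ea]]] /TP[b [e [Ab Eb]]]].
    apply/TP; exists 1%:M, (fun=> 1); split=> //; rewrite mon1 /mconj mulmx1.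
    by rewrite mulVmx.
  by apply/TP; exists (a *m b); eexists; split; [exact: AM | rewrite mconjM // Ea Eb mon_mul].
have TA : T \subset Alt 'I_5.
  apply/fintype.subsetP => t /TP[a [d [Aa Ea]]]; rewrite mem_Alt5.
  have [e [u [eu ne E]]] := HM _ (HA _ Aa); rewrite E in Ea.
  by have [<- _] := mon_inj ne Ea.
have nT : (Group gT <| Alt_group 'I_5)%g.
  apply/andP; split=> //; apply/fintype.subsetP => u; rewrite mem_Alt5 => eu.
  rewrite inE; apply/fintype.subsetP => _ /imsetP[t /TP[a [d [Aa Ea]]] ->]; apply/TP.
  have [e He] := even_lift _ sH _ _ (ltac:(rewrite EH; exact: ext_sp))
    (ltac:(rewrite EH; exact: ext_wp)) _ eu.
  have ne := subgroup_nowhere0 _ _ _ sH He.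
  move: (He); rewrite HP => -[g Gg Eg].
  have ug : g \in unitmx by have [_ _ /(_ _ Gg)[]] := sG.
  exists (mconj g a); eexists; split; first exact: Anorm.
  by rewrite [mconj g a]/mconj !mconjM // mconjV // Eg Ea mon_conj.
have abT t u : t \in T -> u \in T -> (t * u = u * t)%g.
  move=> /TP[a [d [Aa Ea]]] /TP[b [e [Ab Eb]]].
  have nd : nowhere0 d.
    by apply: (@subgroup_nowhere0 _ _ _ t sH); rewrite -Ea; exact: HA.
  have ne : nowhere0 e.
    by apply: (@subgroup_nowhere0 _ _ _ u sH); rewrite -Eb; exact: HA.
  have : mconj P a *m mconj P b = mconj P b *m mconj P a.
    have [f Af ->] := subset_Dmat_mon _ _ AD Aa.
    have [h Ah ->] := subset_Dmat_mon _ _ AD Ab.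
    rewrite -!(mconjM _ _ _ uP) !mon_mul; congr mconj; congr mon; apply/funext => i.
    by rewrite !perm1 mulrC.
  rewrite Ea Eb !mon_mul => /mon_inj[] //.
  by apply: nowhere0_mul => //; apply: nowhere0_comp.
have [_ /(_ _ nT)] := simpleP _ (@simple_Alt5 'I_5 ltac:(by rewrite card_ord)).
(* The alternative T = Alt(5) is excluded because s and w do not commute. *)
case=> /= E; last first.
  have Ts : sp \in T by rewrite E mem_Alt5 even_sp.
  have Tw : wp \in T by rewrite E mem_Alt5 even_wp.
  have /permP/(_ o0) := abT _ _ Ts Tw.
  have /permP/(_ o2) := abT _ _ Ts Tw.
  by rewrite !permM ?spE ?wpE ?spE => /(congr1 val).
move=> a Aa; have [d [t [_ nd Ea]]] := HM _ (HA _ Aa).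
have : t \in T by apply/TP; exists a, d.
rewrite E => /set1P t1; rewrite t1 in Ea.
have := HA _ Aa; rewrite Ea EH => Hd.
exact: (ext_diag _ _ symA' z0' _ z3' Aq').
Qed.

(** From a P = P a' it follows that a_i = a'_j whenever P_ij is nonzero. Nonscalar groups separate
    coordinates, so two nonzero entries can share neither a column (by [A]) nor a row (by [A']). *)
Lemma separating_monomial A A' P :
  sym_inv_diag A -> sym_inv_diag A' -> P \in unitmx ->
  (forall a, A a -> A' (mconj P a)) -> (forall a, A' a -> A (mconj (invmx P) a)) ->
  ~ A `<=` scalars (R := R) -> exists d (t : 'S_5), nowhere0 d /\ P = mon d t.
Proof.
move=> symA symA' uP AA' A'A nsA.
have sep B : sym_inv_diag B -> ~ B `<=` scalars (R := R) ->
    forall i j, (forall d, dset B d -> d i = d j) -> i = j.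
  move=> symB nsB i j Bij; have [sB _ BD _] := symB.
  have [x [x0 x1 Bx]] := nonscalar_delta _ sB BD (sym_even _ symB) nsB.
  apply/eqP; apply: contraT => ij.
  have [k ik jk] : exists2 k, k != i & k != j.
    have : (#|[set i; j]%SET| < #|'I_5|)%N by rewrite cards2 card_ord; case: (i != j).
    rewrite -(cardC (mem [set i; j]%SET)) -[X in (X < _)%N]addn0 ltn_add2l.
    by move=> /card_gt0P[k]; rewrite !inE negb_or => /andP[? ?]; exists k.
  have := Bij _ (Bx i k (ltac:(by rewrite eq_sym))).
  rewrite /delta eqxx (eq_sym j i) (negbTE ij) (eq_sym j k) (negbTE jk) => E.
  by rewrite E eqxx in x1.
have nsA' : ~ A' `<=` scalars (R := R).
  move=> scA'; apply: nsA => a Aa; have /scA'/is_scalar_mxP[x E] := AA' _ Aa.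
  apply/is_scalar_mxP; exists x; rewrite -(mconjVK P a uP) E /mconj.
  by rewrite invmxK scalar_mxC mulmxK.
have [_ _ AD _] := symA; have [_ _ AD' _] := symA'.
have comm d d' : mconj P (mon d 1) = mon d' 1 -> forall i j, P i j != 0 -> d i = d' j.
  move=> E i j Pij; have : mon d 1 *m P = P *m mon d' 1.
    by rewrite -E /mconj !mulmxA (mulmxV uP) mul1mx.
  rewrite !mon_diag => /matrixP/(_ i j).
  by rewrite mul_diag_mx mul_mx_diag !mxE [RHS]mulrC => /(mulIf Pij).
have row_neq0 i : exists j, P i j != 0.
  apply: contrapT => H; have /matrixP/(_ i i) := mulmxV uP.
  rewrite !mxE eqxx big1 => [/eqP|j _]; first by rewrite eq_sym oner_eq0.
  have [->|Pij] := eqVneq (P i j) 0; first by rewrite mul0r.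
  by case: H; exists j.
have [f Pf] := choice row_neq0.
have f_inj : injective f.
  move=> i k fik; apply: (sep A) => // d Ad.
  have [d' _ E] := subset_Dmat_mon _ _ AD' (AA' _ Ad).
  by rewrite (comm _ _ E i (f i)) // (comm _ _ E k (f k)) // fik.
exists (fun i => P i (f i)), (perm f_inj); split=> //.
apply/matrixP => i j; rewrite !mxE permE.
have [<-//|fij] := eqVneq (f i) j; rewrite mulr0n.
apply/eqP; apply: contraT => Pij; case/eqP: fij; apply: (sep A') => // d' Ad'.
have [d _ E] := subset_Dmat_mon _ _ AD (A'A _ Ad').
have E' : mconj P (mon d 1) = mon d' 1 by rewrite -E mconjK.
by rewrite -(comm _ _ E' i (f i)) // -(comm _ _ E' i j).
Qed.

End Uniqueness.

Section UniquenessInU.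
Context {R : realType}.
Local Notation C := (R[i]).
Local Notation M5 := ('M[C]_5).
Implicit Types (G H A : set M5) (d e : 'I_5 -> C) (P : M5).

(** Conjugation by [P] and its inverse exchanges the two diagonal groups. Scalars are fixed by it;
    in the nonscalar case [P] is monomial and only permutes entries, which both groups allow. *)
Lemma mconj_ext_data A A' z z' q q' G H P :
  ext_data A z q G -> ext_data A' z' q' H -> P \in unitmx -> H = mconj P @` G ->
  A = A' /\ (~ A `<=` scalars (R := R) -> exists d (t : 'S_5), nowhere0 d /\ P = mon d t).
Proof.
move=> DG DH uP HP; have AA' := mconj_diag _ _ _ _ _ _ _ _ _ DG DH uP HP.
have GP : G = mconj (invmx P) @` H.
  rewrite HP; apply/seteqP; split=> [g Gg|_ [_ [g Gg <-] <-]]; last by rewrite mconjVK.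
  by exists (mconj P g); [exists g | exact: mconjVK].
have uPV : invmx P \in unitmx by rewrite unitmx_inv.
have A'A := mconj_diag _ _ _ _ _ _ _ _ _ DH DG uPV GP.
have [symA _ _ _ _] := DG; have [symA' _ _ _ _] := DH.
split; last exact: separating_monomial AA' A'A.
have [scA|nsA] := pselect (A `<=` scalars (R := R)).
  have fixA a : A a -> mconj P a = a.
    by move=> /scA/is_scalar_mxP[x ->]; rewrite /mconj -mulmxA -scalar_mxC mulmxA mulVmx ?mul1mx.
  apply/seteqP; split=> a Aa; first by rewrite -(fixA _ Aa); exact: AA'.
  have := A'A _ Aa; set b := mconj _ _ => Ab.
  by rewrite -(mconjK P a uP) (fixA _ Ab).
have [e [t [ne EP]]] := separating_monomial _ _ _ symA symA' uP AA' A'A nsA.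
have [_ _ AD _] := symA; have [_ _ AD' _] := symA'.
have conjE d : mconj P (mon d 1) = mon (fun i => d (t^-1%g i)) 1.
  rewrite /mconj EP mon_conj // conj1g; congr mon.
  by apply/funext => i; rewrite perm1 mulrAC mulVf ?mul1r.
apply/seteqP; split=> a Aa.
  have [d Ad E] := subset_Dmat_mon _ _ AD Aa; rewrite E.
  have := AA' _ Aa; rewrite E conjE => /(sym_inv_comp _ _ t symA').
  by rewrite /dset; congr A'; congr mon; apply/funext => i; rewrite permK.
have := A'A _ Aa; set b := mconj _ _ => Ab.
have [d Ad E] := subset_Dmat_mon _ _ AD Ab.
rewrite -(mconjK P a uP) -/b E conjE.
exact: (sym_inv_comp _ _ t^-1%g symA Ad).
Qed.

(* At the two fixed points of the 3-cycle, an element of the first group has entries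
   whose ratio is a ratio of entries of an element of [A]; for [w c_{n+1}]
   this ratio is [eps_{n+1}^2], of order [3^(n+1)]. *)
Lemma not_GLconj_ext A n G H P :
  ext_data A (eps R n.+1) (3 ^ n) G -> A `&` X3 (R := R) = Omega n ->
  ext_data A 1 1 H -> ~ A `<=` scalars (R := R) ->
  P \in unitmx -> H = mconj P @` G -> False.
Proof.
move=> DG An DH nsA uP HP; have [_ /(_ nsA)[e [u [ne EP]]]] := mconj_ext_data _ _ _ _ _ _ _ _ _ DG DH uP HP.
have [symA EG z0 z3 Aq] := DG; have [_ EH w0 w3 Aq'] := DH; have [sA AD _ _] := symA.
set z := eps R n.+1 in EG z0 z3.
have Hw : H (mconj P (mon (fun i => cvec z (wp i)) wp)).
  by rewrite HP; eexists; last by []; rewrite EG; exact: ext_wp.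
have [a [t [Aa _ E]]] := ext1_form _ _ symA (eq_ind _ (fun X => X _) Hw _ EH).
move: E; rewrite /mconj EP mon_conj // => /mon_inj[|tE aE].
  by move=> i; rewrite !mulf_neq0 ?invr_eq0 //; apply: nowhere0_comp; apply: cvec_nowhere0.
(* At fixed points of the 3-cycle the factors coming from [e] cancel, so conjugation only moves
   these entries. *)
have a3 : a (u o3) = z^-1.
  have := congr1 (fun f => f (u o3)) aE; rewrite /= permK !wpE cvecE => <-.
  by rewrite mulrAC mulVf ?mul1r.
have a4 : a (u o4) = z.
  have := congr1 (fun f => f (u o4)) aE; rewrite /= permK !wpE cvecE => <-.
  by rewrite mulrAC mulVf ?mul1r.
have : dset A (delta o0 o1 (a (u o4) / a (u o3))).
  apply: ratio_delta => //; [exact: dset_group | exact: sym_even | by rewrite (inj_eq perm_inj)].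
rewrite a3 a4 invrK => Ad.
have : (A `&` X3 (R := R)) (mon (delta o0 o1 (z * z)) 1).
  have [X3d _] : Omega n.+1 (mon (delta o0 o1 (z * z)) 1).
    by apply: Omega_delta => //; rewrite exprMn eps_pow1 // mulr1.
  by split.
rewrite An => /Omega_mon[_ /(_ o0)]; rewrite /delta eqxx exprMn epsS_pow => E2.
have := @eps1_neq1 R; rewrite -(@eps1_cube R) !exprS expr0 mulr1 E2 mulr1 eqxx //.
Qed.

(** For n < m, a [delta] with entry [eps n.+1] lies in [Omega m] but not in [Omega n]. *)
Lemma Omega_inj n m : Omega n = Omega m :> set M5 -> n = m.
Proof.
wlog lt : n m / (n < m)%N => [W E|E].
  by case: (ltngtP n m) => // lt; [exact: W | apply: esym; exact: W].
have : Omega m (mon (delta o0 o1 (eps R n.+1)) 1) by apply: Omega_delta; rewrite ?eps_pow1.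
rewrite -E => /Omega_mon[_ /(_ o0)]; rewrite /delta eqxx epsS_pow => /eqP.
by rewrite (negbTE eps1_neq1).
Qed.

(** Conjugate groups share [A]. Within a family this determines the group, as [A] also determines
    [n]; across the families it contradicts [not_GLconj_ext]. *)
Lemma inU_GLconj_eq G H : inU G -> inU H -> GLconj G H -> G = H.
Proof.
move=> UG UH; have [[A [DG nsA]]|[n [A [DG An]]]] := inU_ext _ UG;
  have [[B [DH nsB]]|[m [B [DH Bm]]]] := inU_ext _ UH => cGH.
- have [P [uP HP]] := cGH; have [AB _] := mconj_ext_data _ _ _ _ _ _ _ _ _ DG DH uP HP.
  by have [_ -> _ _ _] := DG; have [_ -> _ _ _] := DH; rewrite AB.
- have [P [uP GP]] := GLconj_sym _ _ cGH.
  have [BA _] := mconj_ext_data _ _ _ _ _ _ _ _ _ DH DG uP GP; rewrite BA in DH Bm.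
  by case: (not_GLconj_ext _ _ _ _ _ DH Bm DG nsA uP GP).
- have [P [uP HP]] := cGH; have [AB _] := mconj_ext_data _ _ _ _ _ _ _ _ _ DG DH uP HP.
  rewrite AB in DG An.
  by case: (not_GLconj_ext _ _ _ _ _ DG An DH nsB uP HP).
- have [P [uP HP]] := cGH; have [AB _] := mconj_ext_data _ _ _ _ _ _ _ _ _ DG DH uP HP.
  have nm : n = m by apply: Omega_inj; rewrite -An -Bm AB.
  by have [_ -> _ _ _] := DG; have [_ -> _ _ _] := DH; rewrite AB nm.
Qed.

End UniquenessInU.

(** * Groups with permutation part Alt(5) *)

Lemma coprime_exp1 {F : fieldType} (x : F) a b :
  (0 < a)%N -> coprime a b -> x ^+ a = 1 -> x ^+ b = 1 -> x = 1.
Proof.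
move=> a0 /eqP ab xa xb; have [k _] := Bezoutl b a0; rewrite ab => /dvdnP[l E].
have : x ^+ (1 + k * b) = 1 by rewrite E mulnC exprM xa expr1n.
by rewrite exprD mulnC exprM xb expr1n mulr1 expr1.
Qed.

(** Take for m the size of [B]. Multiplication by x permutes [B]; comparing products over [B] gives
    x^m = 1. Conversely, X^m - 1 has at most m roots, and [B] already supplies m. *)
Lemma finite_mul_group_roots {F : fieldType} (B : set F) : finite_set B -> B 1 ->
  (forall x y, B x -> B y -> B (x * y)) -> (forall x, B x -> x != 0) ->
  exists2 m, (0 < m)%N & forall x, B x <-> x ^+ m = 1.
Proof.
move=> /finite_seqP[s0 Bs0] B1 BM B0; pose s := undup s0.
have us : uniq s by exact: undup_uniq.
have Bs x : B x <-> x \in s by rewrite Bs0 /= mem_undup.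
have m0 : (0 < size s)%N by move/Bs: B1; case: (s).
have roots x : B x -> x ^+ size s = 1.
  move=> Bx; have x0 := B0 _ Bx.
  have u' : uniq [seq x * y | y <- s] by rewrite map_inj_uniq //; exact: mulfI.
  have sub : {subset [seq x * y | y <- s] <= s}.
    by move=> _ /mapP[y /Bs By ->]; apply/Bs; exact: BM.
  have [_ E] := uniq_min_size u' sub (eq_leq (esym (size_map _ _))).
  have p0 : \prod_(y <- s) y != 0.
    by rewrite prodf_seq_neq0; apply/allP => y /Bs/B0 ->; rewrite implybT.
  apply: (mulIf p0); rewrite mul1r -[RHS](perm_big _ (uniq_perm u' us E)) big_map /=.
  by rewrite big_split /= big_const_seq count_predT -Monoid.iteropE.
exists (size s) => // x; split=> [|xm]; first exact: roots.
apply/Bs; apply: contraT => xs.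
have := @max_unity_roots _ (size s) (x :: s) m0; rewrite /= xs us ltnn => /(_ _ isT) -> //.
apply/andP; split; first by apply/unity_rootP.
by apply/allP => y /Bs/roots E; apply/unity_rootP.
Qed.

Section AltGroups.
Context {R : realType}.
Local Notation C := (R[i]).
Local Notation M5 := ('M[C]_5).
Implicit Types (G H A : set M5) (d e : 'I_5 -> C).

Lemma Dmat_subgroup : is_subgroup (Dmat (R := R)).
Proof.
split=> [|g h|g].
- by rewrite -mon1; apply/DmatP; exists (fun=> 1) => // i; rewrite oner_eq0.
- move=> /DmatP[d nd ->] /DmatP[e ne ->]; apply/DmatP.
  exists (fun i => d i * e i); first exact: nowhere0_mul.
  by rewrite mon_mul mulg1; congr mon; apply/funext => i; rewrite perm1.
- move=> /DmatP[d nd ->]; split; first exact: mon_unit.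
  rewrite mon_invr //; apply/DmatP; exists (fun i => (d i)^-1); first exact: nowhere0_inv.
  by rewrite invg1; congr mon; apply/funext => i; rewrite perm1.
Qed.

Lemma subgroupI G H : is_subgroup G -> is_subgroup H -> is_subgroup (G `&` H).
Proof.
move=> [G1 GM GV] [H1 HM HV]; split=> // [g h [Gg Hg] [Gh Hh]|g [Gg Hg]].
  by split; [exact: GM | exact: HM].
by have [ug GVg] := GV _ Gg; have [_ HVg] := HV _ Hg.
Qed.

Definition alt_group G :=
  [/\ is_subgroup G, finite_set G, G `<=` Mmat (R := R), irreducible G &
      forall t : 'S_5, (exists d, G (mon d t)) <-> ~~ odd_perm t].

Section Diagonal.
Variable G : set M5.
Hypothesis aG : alt_group G.
Local Notation A := (G `&` Dmat (R := R)).

Lemma alt_dset d : dset A d <-> G (mon d 1).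
Proof.
have [sG _ _ _ _] := aG; split=> [[]//|Gd]; split=> //.
by apply/DmatP; exists d => //; exact: subgroup_nowhere0 Gd.
Qed.

Lemma alt_dset_subgroup : is_subgroup A.
Proof. by have [sG _ _ _ _] := aG; apply: subgroupI => //; exact: Dmat_subgroup. Qed.

Lemma alt_even_inv : even_inv (dset A).
Proof.
have [sG _ _ _ Gt] := aG; have [G1 GM GV] := sG.
move=> t d et /alt_dset Gd; apply/alt_dset.
have [e Ge] : exists e, G (mon e t^-1%g) by apply/Gt; rewrite odd_permV.
have ne := subgroup_nowhere0 _ _ _ sG Ge.
have : G (invmx (mon e t^-1%g) *m mon d 1 *m mon e t^-1%g).
  by apply: (GM _ _ _ Ge); apply: GM Gd; have [] := GV _ Ge.
rewrite mon_conj // conj1g invgK; congr G; congr mon; apply/funext => i.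
by rewrite perm1 mulrAC mulVf ?mul1r.
Qed.

(** Even permutations act through elements of [G]. Swapping the entries at 0 and 1 amounts to
    multiplying by [delta o1 o0 (d o0 / d o1)], which is in the group, and this covers the odd
    ones. *)
Lemma alt_sym_inv : sym_inv_diag A.
Proof.
have [sG fG _ _ _] := aG; have sA := alt_dset_subgroup.
have gA := dset_group _ sA; have [A1 AM _ Anz] := gA.
split; [exact: sA | exact: finite_setIl | by move=> g [] | move=> t a Aa].
have [d Ad ->] : exists2 d, dset A d & a = mon d 1 by apply: subset_Dmat_mon Aa => g [].
rewrite -mon_perm mon_conj => [|i]; last exact: oner_neq0.
rewrite conj1g; suff : dset A (fun i => d (t^-1%g i)).
  by rewrite /dset; congr A; congr mon; apply/funext => i; rewrite invr1 mul1r mulr1.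
have comp01 : dset A (fun i => d (tperm o0 o1 i)).
  have nd := Anz _ Ad.
  have := AM _ _ Ad (ratio_delta _ _ o1 o0 o0 o1 gA alt_even_inv Ad isT isT).
  congr (dset A); apply/funext; apply: forall5; rewrite tpE /delta /= ?mulr1 //.
    by rewrite mulrC mulfVK.
  by rewrite invfM invrK mulrA mulfV ?mul1r.
case et : (odd_perm t); last by apply: alt_even_inv; rewrite // odd_permV et.
have := alt_even_inv (t^-1 * tperm o0 o1)%g _ _ comp01.
rewrite odd_permM odd_permV et odd_tperm => /(_ isT).
by congr (dset A); apply/funext => i; rewrite permM tpermK.
Qed.

Lemma alt_delta d i j k l : G (mon d 1) -> i != j -> k != l ->
  G (mon (delta k l (d i / d j)) 1).
Proof.
move=> /alt_dset Ad ij kl; apply/alt_dset.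
exact: (ratio_delta _ _ _ _ _ _ (dset_group _ alt_dset_subgroup) alt_even_inv Ad ij kl).
Qed.

Lemma alt_exponent :
  exists2 m, (0 < m)%N & forall x, G (mon (delta o0 o1 x) 1) <-> x ^+ m = 1.
Proof.
have [sG fG _ _ _] := aG; have [G1 _ _] := sG.
have [A1 AM _ Anz] := dset_group _ sG.
have inj : injective (fun x : C => mon (delta o0 o1 x) 1).
  by move=> x y /matrixP/(_ o0 o0); rewrite !mxE !perm1 eqxx.
apply: finite_mul_group_roots.
- apply: (@finite_preimage _ _ _ (fun x : C => mon (delta o0 o1 x) 1)) fG.
  by move=> x y _ _; exact: inj.
- rewrite /= (_ : delta _ _ _ = fun=> 1) ?mon1 //; apply/funext => i.
  by rewrite /delta invr1 !if_same.
- move=> x y /= Gx Gy; have := AM _ _ Gx Gy; congr G; congr mon; apply/funext => i.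
  by rewrite /delta; case: ifP => // _; case: ifP => _; rewrite ?mulr1 ?invfM.
- by move=> x /= /Anz/(_ o0).
Qed.

Variable m : nat.
Hypothesis Gm : forall x, G (mon (delta o0 o1 x) 1) <-> x ^+ m = 1.

Lemma alt_ratio d i j : G (mon d 1) -> (d i / d j) ^+ m = 1.
Proof.
move=> Gd; have [<-|ij] := eqVneq i j.
  by rewrite mulfV ?expr1n //; have [sG _ _ _ _] := aG; exact: subgroup_nowhere0 Gd _.
by apply/Gm; exact: alt_delta.
Qed.

(** Such a matrix is the product of the matrices [delta k o4 (d k)] for k = 0, ..., 3; the
    determinant fixes the entry at 4. *)
Lemma alt_det1 d : \prod_i d i = 1 -> (forall i, d i ^+ m = 1) -> G (mon d 1).
Proof.
move=> pd dm; have nd := prod_nowhere0 _ pd.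
have [sG _ _ _ _] := aG; have [A1 AM _ _] := dset_group _ sG.
have Gx (x : C) k l : x != 0 -> k != l -> x ^+ m = 1 -> G (mon (delta k l x) 1).
  move=> x0 kl /Gm Gx; have := alt_delta _ o0 o2 k l Gx isT kl.
  by rewrite {2}/delta /= divr1.
have := AM _ _ (AM _ _ (AM _ _ (Gx _ o0 o4 (nd o0) isT (dm _)) (Gx _ o1 o4 (nd o1) isT (dm _)))
  (Gx _ o2 o4 (nd o2) isT (dm _))) (Gx _ o3 o4 (nd o3) isT (dm _)).
congr G; congr mon; apply/funext; apply: forall5; rewrite /delta /= ?mulr1 ?mul1r //.
rewrite -!invfM; apply: (mulIf (_ : d o0 * d o1 * d o2 * d o3 != 0)).
  by rewrite !mulf_neq0.
by rewrite mulVf ?mulf_neq0 // mulrC -prod5 pd.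
Qed.

(** For 3-power order, ratios of entries are m-th roots of unity of 3-power order, so their 3^n-th
    powers are 1. Multiplying the ratios with numerator [d i] and using determinant 1 bounds [d i]
    up to a factor 5, which is prime to 3. *)
Lemma alt_Omega n m' : m = (3 ^ n * m')%N -> coprime 3 m' ->
  A `&` X3 (R := R) = Omega n.
Proof.
move=> mE co; apply/seteqP; split=> g.
  move=> [[Gg /DmatP[d nd E]]]; rewrite E => -[/Xgrp_mon pd [k /mon_exp1 dk]].
  rewrite E in Gg; apply/Omega_mon; split=> // i.
  have rat j : (d i / d j) ^+ (3 ^ n) = 1.
    apply: (@coprime_exp1 _ _ (3 ^ k) m'); rewrite ?expn_gt0 ?coprimeXl //.
      by rewrite -exprM mulnC exprM expr_div_n !dk divr1 expr1n.
    by rewrite -exprM -mE alt_ratio.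
  apply: (@coprime_exp1 _ _ (3 ^ k) 5); rewrite ?expn_gt0 ?coprimeXl //.
    by rewrite -exprM mulnC exprM dk expr1n.
  have : \prod_j (d i / d j) ^+ (3 ^ n) = 1 by rewrite big1.
  by rewrite prodrXl big_split /= prodfV pd invr1 mulr1 prodr_const card_ord -exprM mulnC exprM.
have DO : Omega n g -> exists2 d, nowhere0 d & g = mon d 1.
  by move=> [[[/DmatP]]].
move=> Og; have [d nd E] := DO Og; rewrite E in Og *.
have [X3d _] := Og; move/Omega_mon: Og => [pd dn].
split=> //; apply/alt_dset; apply: alt_det1 => // i.
by rewrite mE exprM dn expr1n.
Qed.

End Diagonal.
End AltGroups.

(** * Normalizing a lift of the 3-cycle by the relations of Alt(5) *)

Definition yp : 'S_5 := (wp ^ (sp * sp))%g.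

Lemma ypE : (yp o0 = o0) * (yp o1 = o1) * (yp o2 = o3) * (yp o3 = o4) * (yp o4 = o2).
Proof.
by do !split; rewrite /yp /conjg invMg !permM !spVE wpE ?spE ?wpE ?spE.
Qed.

(** Writes the 5-cycle as a product of two conjugate 3-cycles, so that a lift of s is built from
    lifts of 3-cycles. *)
Lemma yp_wp : (yp * wp)%g = sp.
Proof. by apply/permP; apply: forall5; rewrite permM ypE wpE spE. Qed.

(* Conjugating by [diag f] turns the lift of [s = yp * wp] into [s] itself. *)
Lemma rescale_to_cycle {F : fieldType} (d b : 'I_5 -> F) :
  \prod_i d i = 1 -> \prod_i b i = 1 -> exists f D,
  [/\ nowhere0 f /\ (forall i, D i = (f i)^-1 * d i * f (wp i)),
      forall i, (f i)^-1 * (b i * d (yp i)) * f (sp i) = 1,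
      \prod_i D i = 1 /\ D o0 * D o1 * D o2 = d o0 * d o1 * d o2,
      D o4 = d o4 /\ b o0 * D o0 = 1 & b o2 * b o3 * b o4 * (D o2 * D o3 * D o4) = 1].
Proof.
move=> pd pb; have nd := prod_nowhere0 _ pd; have nb := prod_nowhere0 _ pb.
pose g i := b i * d (yp i); have ng i : g i != 0 by rewrite mulf_neq0.
have pg : g o0 * g o1 * g o2 * g o3 * g o4 = 1.
  by rewrite -prod5 big_split /= pb mul1r -[RHS]pd [RHS](reindex_inj (@perm_inj _ yp)).
(* Partial products solve f(s i) = f(i) / g(i) along the 5-cycle; the recursion closes up because
   the product of all g(i) is 1. *)
pose f (i : 'I_5) := [:: 1; (g o0)^-1; (g o0 * g o1)^-1; (g o0 * g o1 * g o2)^-1;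
                 (g o0 * g o1 * g o2 * g o3)^-1]`_i.
have nf : nowhere0 f by apply: forall5; rewrite /f /= ?oner_eq0 // invr_eq0 ?mulf_neq0.
have H i : (f i)^-1 * (b i * d (yp i)) * f (sp i) = 1.
  move: i; apply: forall5; rewrite spE -/(g _) /f /= ?invr1 ?mul1r ?invrK ?mulr1 //.
  - by rewrite mulfV.
  - by rewrite mulfV // mulf_neq0.
  - by rewrite mulfV // !mulf_neq0.
  - by rewrite mulfV // !mulf_neq0.
pose D i := (f i)^-1 * d i * f (wp i).
(* The rescaled lifts of [yp] and [wp] multiply to s, so the entries of one are inverse to entries
   of the other. *)
have bD i : (f i)^-1 * b i * f (yp i) * D (yp i) = 1.
  by rewrite -[RHS](H i) -yp_wp (permM yp wp) /D; field; rewrite !nf.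
exists f, D; split=> //.
- split; first by rewrite prod5 /D !wpE -[RHS]pd prod5; field; rewrite !nf.
  by rewrite /D !wpE; field; rewrite !nf.
- split; first by rewrite /D !wpE; field; rewrite !nf.
  by rewrite -[RHS](bD o0) ypE -/(D o0); field; rewrite nf.
transitivity ((f o2)^-1 * b o2 * f o3 * D o3 * ((f o3)^-1 * b o3 * f o4 * D o4)
   * ((f o4)^-1 * b o4 * f o2 * D o2)).
  by move: (D o2) (D o3) (D o4) => *; field; rewrite !nf.
by have := bD o2; have := bD o3; have := bD o4; rewrite !ypE => -> -> ->; rewrite !mul1r.
Qed.

(* [(0 1 2)(1 2 3)] is an involution. *)
Lemma involution_relation {F : fieldType} (D : 'I_5 -> F) : exists2 c,
  let V := mon D wp *m mon (fun=> 1^-1) sp^-1 *m mon D wp *m mon (fun=> 1) sp in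
  V *m V = mon c 1 & c o0 = D o0 ^+ 2 * (D o2 * D o4) /\ c o4 = (D o4 * D o3) ^+ 2.
Proof.
pose e i := D i * D ((sp^-1)%g (wp i)).
have E : mon D wp *m mon (fun=> 1^-1) sp^-1 *m mon D wp *m mon (fun=> 1) sp =
         mon e (tperm o0 o2 * tperm o1 o3)%g.
  rewrite !mon_mul; congr mon.
    by apply/funext => i; rewrite /e invr1 !mulr1 permM.
  by apply/permP; apply: forall5; rewrite !permM ?wpE ?spVE ?wpE ?spE !tpE.
exists (fun i => e i * e ((tperm o0 o2 * tperm o1 o3)%g i)).
  rewrite /= E mon_mul; congr mon.
  by apply/permP; apply: forall5; rewrite !permM !tpE perm1.
by rewrite !permM !tpE /= /e !wpE !spVE; split; rewrite !expr2 ?mulrA.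
Qed.

(** The products give a3 a4 = 1, a2 = 1 and a0 a1 = 1; the last relation becomes a0^2 a4 = 1, and
    a0^3 = 1 yields a0 = a4. *)
Lemma normal_form_entries {F : fieldType} (a0 a1 a2 a3 a4 : F) :
  a0 * a1 * a2 * a3 * a4 = 1 -> a0 * a1 * a2 = 1 -> a2 * a3 * a4 = 1 -> a0 ^+ 3 = 1 ->
  a0 ^+ 2 * (a2 * a4) = (a4 * a3) ^+ 2 ->
  [/\ a0 = a4, a1 = a4^-1, a2 = 1 & a3 = a4^-1].
Proof.
move=> p p012 p234 c0 r.
have n0 : a0 != 0 by apply/eqP => E; move/eqP: c0; rewrite E expr0n eq_sym oner_eq0.
have a34 : a3 * a4 = 1 by rewrite -[RHS]p p012 mul1r.
have a2E : a2 = 1 by rewrite -[RHS]p234 -mulrA a34 mulr1.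
have a01 : a0 * a1 = 1 by rewrite -[RHS]p012 a2E mulr1.
have a04 : a0 = a4.
  apply: (mulfI (expf_neq0 2 n0)); rewrite -exprSr c0.
  by rewrite a2E mul1r mulrC in r; rewrite mulrC r mulrC a34 expr1n.
split=> //; first by rewrite -a04; apply: (mulfI n0); rewrite mulfV.
by apply: (mulIf n0); rewrite a04 a34 mulVf // -a04.
Qed.

(** * Power maps whose kernel is the m-th roots of unity *)

Section PowerMap.
Context {R : realType}.
Local Notation C := (R[i]).

(** Applying [h] to the entries forgets exactly the m-th roots of unity, that is, the freedom given
    by the determinant-1 diagonal matrices in [G]. *)
Definition power_map m (h : C -> C) :=
  [/\ h 1 = 1, forall x y, h (x * y) = h x * h y, forall x, x != 0 -> h x != 0 &
      forall x, h x = 1 <-> x ^+ m = 1].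

(* The witness is [x ^+ m] or [x ^- m], according to [m'] modulo 3. *)
Lemma exists_power_map m : (0 < m)%N -> exists n m' h,
  [/\ m = (3 ^ n * m')%N, coprime 3 m', power_map m h & h (eps R n.+1) = eps R 1].
Proof.
move=> m0; have [m' co mE] := pfactor_coprime (isT : prime 3) m0.
set n := logn 3 m in mE; exists n, m'; rewrite mulnC in mE.
have E : eps R n.+1 ^+ m = eps R 1 ^+ (m' %% 3).
  rewrite {1}mE exprM epsS_pow {1}(divn_eq m' 3) exprD mulnC exprM.
  by rewrite eps1_cube expr1n mul1r.
have [r1|r2] : (m' %% 3 = 1 \/ m' %% 3 = 2)%N.
  have : (m' %% 3 < 3)%N by rewrite ltn_mod.
  have : (m' %% 3 != 0)%N by rewrite -/(dvdn 3 m') -prime_coprime.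
  by case: (m' %% 3)%N => [|[|[|]]] // _ _; [left | right].
- exists (fun x => x ^+ m); split=> //; last by rewrite E r1.
  by split=> // [||x]; [exact: expr1n | exact: exprMn | exact: expf_neq0].
- exists (fun x => x^-1 ^+ m); split=> //.
    split=> // [||x x0|x]; [by rewrite invr1 expr1n | by move=> x y; rewrite invfM exprMn | |].
      by rewrite expf_neq0 ?invr_eq0.
    by rewrite exprVn; split=> [/(congr1 GRing.inv)|->]; rewrite ?invrK invr1.
  rewrite exprVn E r2; apply: (mulfI (expf_neq0 2 (eps_neq0 1))).
  by rewrite mulfV ?expf_neq0 ?eps_neq0 // -exprSr eps1_cube.
Qed.

Variables (m : nat) (h : C -> C).
Hypothesis hP : power_map m h.

Lemma power_mapV x : x != 0 -> h x^-1 = (h x)^-1.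
Proof.
have [h1 hM h0 _] := hP; move=> x0; apply: (mulfI (h0 _ x0)).
by rewrite -hM !mulfV ?h0.
Qed.

Lemma power_mapX x k : h (x ^+ k) = h x ^+ k.
Proof.
have [h1 hM _ _] := hP.
by elim: k => [|k IH]; rewrite ?expr0 ?h1 // !exprS hM IH.
Qed.

Lemma power_map_cvec z i : z != 0 -> h (cvec z i) = cvec (h z) i.
Proof.
have [h1 _ _ _] := hP; move=> z0; move: i.
by apply: forall5; rewrite !cvecE ?power_mapV ?h1.
Qed.

End PowerMap.

(** * Conjugation to a standard form *)

Section Existence.
Context {R : realType}.
Local Notation C := (R[i]).
Local Notation M5 := ('M[C]_5).
Implicit Types (G H A : set M5) (d e f b D : 'I_5 -> C).

Lemma mconj_mon_diag f (u : 'S_5) d : nowhere0 f ->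
  mconj (mon f u) (mon d 1) = mon (fun i => d (u^-1%g i)) 1.
Proof.
move=> nf; rewrite /mconj mon_conj // conj1g; congr mon.
by apply/funext => i; rewrite perm1 mulrAC mulVf ?mul1r.
Qed.

Lemma alt_mconj G f (u : 'S_5) : nowhere0 f -> alt_group G -> alt_group (mconj (mon f u) @` G).
Proof.
move=> nf [sG fG GM iG Gt]; have [G1 GMul GV] := sG.
set P := mon f u; have uP : P \in unitmx by exact: mon_unit.
split.
- split.
  + by exists 1%:M => //; rewrite /mconj mulmx1 mulVmx.
  + by move=> _ _ [g Gg <-] [k Gk <-]; exists (g *m k); [exact: GMul | exact: mconjM].
  + move=> _ [g Gg <-]; have [ug Gi] := GV _ Gg.
    split; first by rewrite !unitmx_mul unitmx_inv uP ug.
    by exists (invmx g) => //; exact: mconjV.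
- exact: finite_image.
- move=> _ [g Gg <-]; have /MmatP[d [t [nd ->]]] := GM _ Gg.
  apply/MmatP; rewrite /mconj mon_conj //; eexists; eexists; split; last by [].
  by move=> i; rewrite !mulf_neq0 ?invr_eq0.
- move=> U UG.
  have <- : \rank (U *m invmx P) = \rank U by rewrite mxrankMfree // row_free_unit unitmx_inv.
  apply: iG => g Gg; have := UG (mconj P g) (ltac:(by exists g)).
  by move=> /(submxMr (invmx P)); rewrite /mconj !mulmxA mulmxK.
- move=> t; split=> [[d [g Gg E]]|et].
    have /MmatP[e [v [ne Eg]]] := GM _ Gg; move: E; rewrite Eg /mconj mon_conj // => /mon_inj[].
      by move=> i; rewrite !mulf_neq0 ?invr_eq0.
    by move=> <- _; rewrite odd_permJ; apply/Gt; exists e; rewrite -Eg.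
  have [d Gd] : exists d, G (mon d (t ^ u^-1)%g) by apply/Gt; rewrite odd_permJ.
  by eexists; exists (mon d (t ^ u^-1)%g) => //; rewrite /mconj mon_conj // conjgKV.
Qed.

Lemma alt_mconj_exponent G f (u : 'S_5) m : nowhere0 f -> alt_group G ->
  (forall x, G (mon (delta o0 o1 x) 1) <-> x ^+ m = 1) ->
  forall x, (mconj (mon f u) @` G) (mon (delta o0 o1 x) 1) <-> x ^+ m = 1.
Proof.
move=> nf aG Gm x; have symA := alt_sym_inv _ aG.
have sub d (v : 'S_5) : G (mon d 1) -> G (mon (fun i => d (v i)) 1).
  by move=> /(alt_dset _ aG)/(sym_inv_comp _ _ v symA)/(alt_dset _ aG).
rewrite -Gm; split=> [[g Gg E]|Gd].
  have uP : mon f u \in unitmx by exact: mon_unit.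
  have := mconj_mon_diag f u (fun i => delta o0 o1 x (u i)) nf.
  have -> : (fun i => delta o0 o1 x (u (u^-1%g i))) = delta o0 o1 x.
    by apply/funext => i; rewrite permKV.
  rewrite -E => /(congr1 (mconj (invmx (mon f u)))); rewrite !mconjVK // => Eg.
  rewrite E.
  have -> : delta o0 o1 x = fun i => delta o0 o1 x (u (u^-1%g i)).
    by apply/funext => i; rewrite permKV.
  by apply: (sub (fun i => delta o0 o1 x (u i)) u^-1%g); rewrite Eg.
exists (mon (fun i => delta o0 o1 x (u i)) 1); first exact: sub.
by rewrite mconj_mon_diag //; congr mon; apply/funext => i; rewrite permKV.
Qed.

Lemma ext_sub_of_gens G z A : is_subgroup G -> G (mon (fun=> 1) sp) ->
  G (mon (fun i => cvec z (wp i)) wp) -> A `<=` G -> ext z A `<=` G.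
Proof.
move=> sG Gs Gw AG; rewrite /ext; apply: gen_subset => // g [[->|->]|/AG //].
  by rewrite smatE.
by rewrite wmat_cvec.
Qed.

(** The group on the right lies in [G], lifts the same permutations and has all of the diagonal part
    of [G]; dividing [g] by a lift of its permutation leaves a diagonal element of [G]. *)
Lemma eq_ext G z : alt_group G -> z != 0 -> G (mon (fun=> 1) sp) ->
  G (mon (fun i => cvec z (wp i)) wp) -> G = ext z (G `&` Dmat (R := R)).
Proof.
move=> aG z0 Gs Gw; have [sG _ GM _ Gt] := aG; have symA := alt_sym_inv _ aG.
have AG : G `&` Dmat (R := R) `<=` G by move=> g [].
have EG := ext_sub_of_gens _ _ _ sG Gs Gw AG.
apply/seteqP; split=> // g Gg; have /MmatP[d [t [nd E]]] := GM _ Gg.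
have sE := ext_subgroup _ z symA z0.
have et : ~~ odd_perm t by apply/Gt; exists d; rewrite -E.
have [e Ee] := even_lift _ sE _ _ (ext_sp _ _) (ext_wp _ _) _ et.
have ne := subgroup_nowhere0 _ _ _ sE Ee.
have [_ EM _] := sE.
have -> : g = mon (fun i => d i / e i) 1 *m mon e t.
  by rewrite mon_mul mul1g E; congr mon; apply/funext => i; rewrite perm1 mulfVK.
apply: (EM _ _ _ Ee); apply: sub_ext; apply/(alt_dset _ aG).
rewrite E in Gg; have := subgroup_monM _ _ _ _ _ sG Gg (subgroup_monV _ _ _ sG (EG _ Ee)).
by rewrite mulgV; congr G; congr mon; apply/funext => i; rewrite permK.
Qed.

Section Normalization.
Variables (m : nat) (h : C -> C).
Hypothesis hP : power_map m h.

(** The quotient of w c by the lift [D] is diagonal of determinant 1 with entries in the kernel of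
    [h], hence lies in [G]. *)
Lemma eq_ext_of_lift G z D : alt_group G ->
  (forall x, G (mon (delta o0 o1 x) 1) <-> x ^+ m = 1) -> z != 0 ->
  G (mon (fun=> 1) sp) -> G (mon D wp) -> \prod_i D i = 1 ->
  (forall i, h (D i) = cvec (h z) (wp i)) -> G = ext z (G `&` Dmat (R := R)).
Proof.
move=> aG Gm z0 Gs GD pD hD; apply: eq_ext => //.
have [sG _ _ _ _] := aG; have [_ hM h0 hK] := hP; have nD := prod_nowhere0 _ pD.
have nc : nowhere0 (fun i => cvec z (wp i)) by apply: nowhere0_comp; exact: cvec_nowhere0.
have pc : \prod_i cvec z (wp i) = 1.
  by rewrite prod5 !wpE !cvecE mulrV ?unitfE // !mul1r mulVf.
have Gc : G (mon (fun i => cvec z (wp i) / D i) 1).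
  apply: (alt_det1 _ aG m Gm) => [|i]; first by rewrite big_split /= prodfV pD pc invr1 mulr1.
  by apply/hK; rewrite hM (power_mapV _ _ hP) // (power_map_cvec _ _ hP) // hD mulfV // -hD h0.
have := subgroup_monM _ _ _ _ _ sG Gc GD; rewrite mul1g; congr G; congr mon.
by apply/funext => i; rewrite perm1 mulfVK.
Qed.

(** All conditions concern determinants, products around a 3-cycle, or entries at fixed points:
    quantities unchanged by diagonal conjugation. *)
Definition good_pair G d b :=
  [/\ G (mon d wp) /\ G (mon b yp), \prod_i d i = 1, \prod_i b i = 1,
      h (d o0 * d o1 * d o2) = 1 & [/\ h (d o4) ^+ 3 = 1, h (b o0) ^+ 3 = 1 &
      h (b o2 * b o3 * b o4) = 1]].

Lemma good_pair_normal_form G d b : alt_group G ->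
  (forall x, G (mon (delta o0 o1 x) 1) <-> x ^+ m = 1) -> good_pair G d b ->
  exists2 f, nowhere0 f & let H := mconj (mon f 1) @` G in
    H (mon (fun=> 1) sp) /\ exists D, [/\ H (mon D wp), \prod_i D i = 1 &
      forall i, h (D i) = cvec (h (d o4)) (wp i)].
Proof.
move=> aG Gm [[Gd Gb] pd pb hd [_ hb hb']]; have [h1 hM h0 hK] := hP.
have [f [D [[nf DE] bD [pD D012] [D4 b0] b234]]] := rescale_to_cycle _ _ pd pb.
exists f; first exact: nf.
move=> H.
have aH : alt_group H by exact: alt_mconj.
have Hm := alt_mconj_exponent _ _ 1%g m nf aG Gm.
have [sG _ _ _ _] := aG; have [sH _ _ _ _] := aH.
have nD := prod_nowhere0 _ pD.
have Hs : H (mon (fun=> 1) sp).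
  exists (mon b yp *m mon d wp); first by case: sG => _ GM _; exact: GM.
  rewrite mon_mul yp_wp /mconj mon_conj // conjg1; congr mon.
  by apply/funext => i; rewrite invg1 perm1 bD.
have HD : H (mon D wp).
  exists (mon d wp) => //; rewrite /mconj mon_conj // conjg1; congr mon.
  by apply/funext => i; rewrite invg1 perm1 DE.
split=> //; exists D; split=> //.
have [c Ec [c0 c4]] := involution_relation D; move: Ec; cbv zeta; set V := mon D wp *m _ *m _ *m _ => Ec.
have Hc : H (mon c 1).
  have [_ HM _] := sH; have HsV := subgroup_monV _ _ _ sH Hs.
  have HV : H V by apply: (HM _ _ _ Hs); apply: (HM _ _ _ HD); exact: HM.
  by rewrite -Ec; exact: HM.
have nc := subgroup_nowhere0 _ _ _ sH Hc.
(* The square of the lifted involution is diagonal in [H], so the ratios of its entries are m-th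
   roots of unity. *)
have hc : h (c o0) = h (c o4).
  have /hK := alt_ratio _ aH m Hm c o0 o4 Hc; rewrite hM (power_mapV _ _ hP) // => E.
  by apply: (mulIf (_ : (h (c o4))^-1 != 0)); rewrite ?invr_eq0 ?h0 // E mulfV ?h0.
have [a0 a1 a2 a3] : [/\ h (D o0) = h (D o4), h (D o1) = (h (D o4))^-1, h (D o2) = 1
    & h (D o3) = (h (D o4))^-1].
  apply: normal_form_entries.
  - by rewrite -!hM -prod5 pD.
  - by rewrite -!hM D012.
  - rewrite -!hM; transitivity (h (b o2 * b o3 * b o4) * h (D o2 * D o3 * D o4)).
      by rewrite hb' mul1r.
    by rewrite -hM b234.
  - transitivity (h (b o0) ^+ 3 * h (D o0) ^+ 3); first by rewrite hb mul1r.
    by rewrite -exprMn -hM b0 h1 expr1n.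
  - by move: hc; rewrite c0 c4 !expr2 !hM.
rewrite -D4 in a0 a1 a2 a3 *.
by apply: forall5; rewrite wpE cvecE.
Qed.

(** The transposition (3 4) commutes with [wp] and inverts [yp], so the second lift is conjugated
    and then inverted. It exchanges the entries of [d] at 3 and 4, whose images under [h] are
    mutually inverse. *)
Lemma good_pair_swap G d b : alt_group G -> good_pair G d b ->
  exists d' b', good_pair (mconj (mon (fun=> 1) (tperm o3 o4)) @` G) d' b' /\
    h (d' o4) = (h (d o4))^-1.
Proof.
move=> aG [[Gd Gb] pd pb hd [hd4 hb hb']]; have [h1 hM h0 hK] := hP.
have nd := prod_nowhere0 _ pd; have nb := prod_nowhere0 _ pb.
have n1 : nowhere0 (fun _ : 'I_5 => 1 : C) by move=> i; rewrite oner_eq0.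
set t := tperm o3 o4; set H := _ @` _; have aH : alt_group H by exact: alt_mconj.
have [sH _ _ _ _] := aH.
have conjE e (v : 'S_5) : mconj (mon (fun=> 1) t) (mon e v) = mon (fun i => e (t i)) (v ^ t)%g.
  rewrite /mconj mon_conj //; congr mon; apply/funext => i.
  by rewrite invr1 mul1r mulr1 tpermV.
have h34 : h (d o3) = (h (d o4))^-1.
  apply: (mulIf (h0 _ (nd o4))); rewrite mulVf ?h0 // -hM.
  transitivity (h (d o0 * d o1 * d o2) * h (d o3 * d o4)); first by rewrite hd mul1r.
  by rewrite -hM mulrA -prod5 pd h1.
have wt : (wp ^ t)%g = wp.
  by apply/permP; apply: forall5; rewrite (permM t^-1%g) (permM wp) tpermV !tpE /= !wpE.
have yt : (yp ^ t)%g = yp^-1%g.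
  apply: (mulgI yp); rewrite mulgV; apply/permP; apply: forall5;
  by rewrite (permM yp) ypE (permM t^-1%g) (permM yp) tpermV !tpE /= !ypE perm1.
have Hd : H (mon (fun i => d (t i)) wp) by exists (mon d wp); [|rewrite conjE wt].
have Hb : H (mon (fun i => (b (t (yp i)))^-1) yp).
  have Hb' : H (mon (fun i => b (t i)) yp^-1) by exists (mon b yp); [|rewrite conjE yt].
  by have := subgroup_monV _ _ _ sH Hb'; rewrite invgK.
exists (fun i => d (t i)), (fun i => (b (t (yp i)))^-1); split; last by rewrite tpE.
split=> //.
- by rewrite -[RHS]pd [RHS](reindex_inj (@perm_inj _ t)).
- rewrite prodfV -[RHS]invr1 -[in RHS]pb; congr (_^-1).
  rewrite [RHS](reindex_inj (@perm_inj _ (yp * t)%g)) /=.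
  by apply: eq_bigr => i _; rewrite permM.
- by rewrite !tpE.
- split; first by rewrite tpE /= h34 exprVn hd4 invr1.
  + by rewrite ypE tpE /= (power_mapV _ _ hP) // exprVn hb invr1.
  + rewrite !ypE !tpE /= -!invfM (power_mapV _ _ hP) ?mulf_neq0 //.
    by rewrite (_ : b o4 * b o3 * b o2 = b o2 * b o3 * b o4) ?hb' ?invr1 //; ring.
Qed.

End Normalization.
End Existence.

(** * Existence of suitable lifts and conjugacy into the list *)

Lemma telescope3 {F : fieldType} (k0 k1 k2 x y z : F) : k0 != 0 -> k1 != 0 -> k2 != 0 ->
  (k0^-1 * x * k1) * (k1^-1 * y * k2) * (k2^-1 * z * k0) = x * y * z.
Proof. by move=> n0 n1 n2; field; rewrite n0 n1 n2. Qed.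

(** The double transposition inverts the 3-cycle, so the commutator is w^-2 = w. A commutator of
    lifts is then a lift of w of determinant 1. *)
Lemma wp_commutator : [~ wp, tperm o0 o1 * tperm o3 o4]%g = wp.
Proof.
set v := (_ * tperm o3 o4)%g; have wv : (wp * v = v * (wp * wp))%g.
  by apply/permP; apply: forall5; rewrite !permM wpE !tpE /= !wpE.
by apply: (mulgI wp); rewrite /commg mulKVg /conjg wv mulKg.
Qed.

Lemma cube_roots {F : fieldType} (a w : F) : a ^+ 3 = 1 -> w ^+ 3 = 1 -> w != 1 ->
  a = 1 \/ a = w \/ a = w ^+ 2.
Proof.
move=> a3 w3 w1; have w2 : w ^+ 2 + w + 1 = 0.
  apply: (mulfI (_ : w - 1 != 0)); first by rewrite subr_eq0.
  by rewrite mulr0; ring: w3.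
have : (a - 1) * (a - w) * (a - w ^+ 2) = 0.
  transitivity (a ^+ 3 - (a ^+ 2 - a * w) * (w ^+ 2 + w + 1) - w ^+ 3); first by ring.
  by rewrite a3 w3 w2 mulr0 subr0 subrr.
by move/eqP; rewrite !mulf_eq0 !subr_eq0 => /orP[/orP[]|] /eqP ->; [left | right; left | right; right].
Qed.

Section Existence2.
Context {R : realType}.
Local Notation C := (R[i]).
Local Notation M5 := ('M[C]_5).
Implicit Types (G H A : set M5) (d e f b D : 'I_5 -> C).

Lemma det_mconj (P g : M5) : P \in unitmx -> \det (mconj P g) = \det g.
Proof.
by move=> uP; rewrite /mconj !det_mulmx det_inv mulrAC mulVr ?mul1r.
Qed.

(** A commutator gives a determinant-1 lift [a] of w. Its cube [c] is diagonal in [G], so [h] has a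
    constant value [mu] on its entries, and correcting [a] by a power of [c] normalizes it; [b] is a
    conjugate of the result by a lift of s^2. *)
Lemma exists_good_pair G m h : alt_group G ->
  (forall x, G (mon (delta o0 o1 x) 1) <-> x ^+ m = 1) -> power_map m h ->
  exists d b, good_pair h G d b.
Proof.
move=> aG Gm hP; have [h1 hM h0 hK] := hP; have [sG _ _ _ Gt] := aG; have [G1 GM GV] := sG.
have Gconj g k : G g -> G k -> G (mconj k g).
  by move=> Gg Gk; apply: (GM _ _ _ Gk); apply: GM Gg; have [] := GV _ Gk.
have [e Ge] : exists e, G (mon e wp) by apply/Gt; rewrite even_wp.
have [f Gf] : exists f, G (mon f (tperm o0 o1 * tperm o3 o4)).
  by apply/Gt; rewrite odd_permM !odd_tperm.
have ne := subgroup_nowhere0 _ _ _ sG Ge; have nf := subgroup_nowhere0 _ _ _ sG Gf.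
have [a [Ga pa]] : exists a, G (mon a wp) /\ \prod_i a i = 1.
  have [_ GVe] := GV _ Ge.
  have Gg : G (invmx (mon e wp) *m mconj (mon f (tperm o0 o1 * tperm o3 o4)) (mon e wp)).
    by apply: GM => //; exact: Gconj.
  have dg : \det (invmx (mon e wp) *m mconj (mon f (tperm o0 o1 * tperm o3 o4)) (mon e wp)) = 1.
    by rewrite det_mulmx det_mconj ?mon_unit // det_inv mulVr // -unitmxE mon_unit.
  move: Gg dg; rewrite /mconj mon_conj // mon_invr // mon_mul.
  rewrite -[(_ * _ ^ _)%g]/([~ wp, tperm o0 o1 * tperm o3 o4]%g) wp_commutator.
  set a := (fun _ => _) => Ga; rewrite det_mon even_wp expr0 mul1r => pa.
  by exists a.
have [c cE] : exists c, forall i, c i = a i * a (wp i) * a (wp (wp i)) by eexists.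
have Gc : G (mon c 1).
  have := subgroup_monM _ _ _ _ _ sG (subgroup_monM _ _ _ _ _ sG Ga Ga) Ga.
  rewrite (_ : (wp * wp * wp)%g = 1%g); last first.
    by apply/permP; apply: forall5; rewrite !permM ?wpE perm1.
  by congr G; congr mon; apply/funext => i; rewrite cE permM.
have nc := subgroup_nowhere0 _ _ _ sG Gc.
have hc i : h (c i) = h (c o0).
  have /hK := alt_ratio _ aG m Gm c i o0 Gc; rewrite hM (power_mapV _ _ hP) // => E.
  by apply: (mulIf (_ : (h (c o0))^-1 != 0)); rewrite ?invr_eq0 ?h0 // E mulfV ?h0.
have pc : \prod_i c i = 1.
  have pw : \prod_i a (wp i) = 1 by rewrite -[RHS]pa [RHS](reindex_inj (@perm_inj _ wp)).
  rewrite (eq_bigr _ (fun i _ => cE i)) !big_split /= pa pw !mul1r -[RHS]pw.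
  by rewrite [RHS](reindex_inj (@perm_inj _ wp)).
set mu := h (c o0) in hc.
have mu10 : mu ^+ 10 = 1.
  have : mu ^+ 5 = 1 by rewrite -h1 -pc prod5 !hM !hc !exprS expr0 mulr1 !mulrA.
  by rewrite (exprM mu 5 2) => ->; rewrite expr1n.
(* The exponent 3 turns the product around the cycle, of value [mu], into mu^(9+1), which is 1 since
   the determinant of [c] gives mu^5 = 1. *)
pose d i := c i ^+ 3 * a i.
have Gd : G (mon d wp).
  have := subgroup_exp _ _ 3 sG Gc; rewrite mon_exp => Gc3.
  have := subgroup_monM _ _ _ _ _ sG Gc3 Ga; rewrite mul1g; congr G; congr mon.
  by apply/funext => i; rewrite perm1.
have pd : \prod_i d i = 1 by rewrite big_split /= prodrXl pc pa expr1n mulr1.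
have hd i : h (d i) = mu ^+ 3 * h (a i) by rewrite hM (power_mapX _ _ hP) hc.
have h012 : h (d o0 * d o1 * d o2) = 1.
  rewrite (hM _ (d o2)) (hM (d o0)) !hd -mu10 (exprD mu 9 1) expr1.
  have -> : mu = h (a o0) * h (a o1) * h (a o2) by rewrite /mu cE !wpE !hM.
  by move: (h (a o0)) (h (a o1)) (h (a o2)) => x y z; rewrite (exprM _ 3 3) !exprS !expr0 !mulr1; ring.
have hfix i : wp i = i -> h (d i) ^+ 3 = 1.
  move=> wi; rewrite hd -mu10 exprMn -(exprM mu 3 3) (exprD mu 9 1) expr1.
  by congr (_ * _); rewrite -(hc i) cE !wi !hM !exprS expr0 mulr1 mulrA.
have [k Gk] : exists k, G (mon k (sp * sp)) by apply/Gt; rewrite odd_permM even_sp.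
have nk := subgroup_nowhere0 _ _ _ sG Gk.
have Gb := Gconj _ _ Gd Gk.
have pb : \det (mconj (mon k (sp * sp)) (mon d wp)) = 1.
  by rewrite det_mconj ?mon_unit // det_mon even_wp expr0 mul1r.
move: Gb pb; rewrite /mconj mon_conj // -/yp; set b := (fun _ => _) => Gb.
rewrite det_mon odd_permJ even_wp expr0 mul1r => pb.
exists d, b; split=> //; split; first by apply: hfix; rewrite wpE.
- suff -> : b o0 = d o3 by apply: hfix; rewrite wpE.
  by rewrite /b invMg !permM !spVE wpE mulrAC mulVf ?mul1r.
- rewrite -[RHS]h012; congr h; rewrite /b invMg !permM !spVE !wpE.
  by apply: telescope3; exact: nk.
Qed.

(** Otherwise all elements would be scalar multiples of permutation matrices and preserve the line
    spanned by the all-ones vector. *)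
Lemma alt_group_scalar G : alt_group G -> G = ext 1 (G `&` Dmat (R := R)) ->
  ~ G `&` Dmat (R := R) `<=` scalars (R := R).
Proof.
move=> aG EG scA; have [_ _ _ iG _] := aG.
have symA := alt_sym_inv _ aG; have [sA _ _ _] := symA; have [A1 _ _ _] := dset_group _ sA.
have stab g : G g -> stablemx (const_mx 1 : M5) g.
  rewrite {1}EG => Gg; have [a [t [Aa _ ->]]] := ext1_form _ _ symA Gg.
  have /scalar_mon aE := scA _ Aa.
  rewrite (_ : const_mx 1 *m _ = a o0 *: const_mx 1) ?scalemx_sub //.
  apply/matrixP => i j; rewrite !mxE (bigD1 (t^-1%g j)) //= big1 => [|l lj].
    by rewrite !mxE permKV eqxx addr0 mul1r mulr1 mulr1n; exact: aE.
  by rewrite !mxE -(inj_eq (@perm_inj _ t^-1%g)) permK (negbTE lj) mulr0.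
set U : M5 := const_mx 1 in stab.
have rk1 : (\rank U <= 1)%N.
  have -> : U = (const_mx 1 : 'cV[C]_5) *m (const_mx 1 : 'rV[C]_5).
    by apply/matrixP => i j; rewrite !mxE big_ord1 !mxE mulr1.
  exact: leq_trans (mxrankM_maxl _ _) (rank_leq_col _).
have [r0|r5] := iG _ stab; last by rewrite r5 in rk1.
have /matrixP/(_ o0 o0) : U = 0 by apply/eqP; rewrite -mxrank_eq0 r0.
by rewrite !mxE => /eqP; rewrite oner_eq0.
Qed.

Lemma GLconj_trans G H K : GLconj G H -> GLconj H K -> GLconj G K.
Proof.
move=> [P [uP ->]] [Q [uQ ->]]; exists (P *m Q); split; first by rewrite unitmx_mul uP.
have E g : invmx Q *m (invmx P *m g *m P) *m Q = invmx (P *m Q) *m g *m (P *m Q).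
  have -> : invmx (P *m Q) = invmx Q *m invmx P.
    have u : P *m Q \in unitmx by rewrite unitmx_mul uP.
    apply: (can_inj (mulKmx u)); rewrite mulmxV // !mulmxA mulmxK // mulmxV //.
  by rewrite !mulmxA.
apply/seteqP; split=> [_ [_ [g Gg <-] <-]|_ [g Gg <-]]; first by exists g; rewrite ?E.
by exists (invmx P *m g *m P); [exists g | exact: E].
Qed.

(** The value 1 leads to [z = 1] and the first family; the value [eps 1], which is the image of
    [eps n.+1] under [h], leads to the second. *)
Lemma alt_GLconj_inU_of_pair G m n m' h d b : alt_group G ->
  (forall x, G (mon (delta o0 o1 x) 1) <-> x ^+ m = 1) -> power_map m h ->
  m = (3 ^ n * m')%N -> coprime 3 m' -> h (eps R n.+1) = eps R 1 -> good_pair h G d b ->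
  h (d o4) = 1 \/ h (d o4) = eps R 1 -> exists H, inU H /\ GLconj G H.
Proof.
move=> aG Gm hP mE co he gp ha; have [h1 _ _ _] := hP.
have [f nf [Hs [D [HD pD hD]]]] := good_pair_normal_form _ _ hP _ _ _ aG Gm gp.
set H := _ @` _ in Hs HD; exists H; split; last first.
  by exists (mon f 1); split; first exact: mon_unit.
have aH : alt_group H by exact: alt_mconj.
have Hm : forall x, H (mon (delta o0 o1 x) 1) <-> x ^+ m = 1 by exact: alt_mconj_exponent.
case: ha hD => -> hD.
  have EH : H = ext 1 (H `&` Dmat (R := R)).
    by apply: (eq_ext_of_lift _ _ hP _ 1 D aH Hm (oner_neq0 _) Hs HD pD); rewrite h1.
  left; exists (H `&` Dmat (R := R)); split; last by rewrite {1}EH ext1.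
    exact: alt_sym_inv.
  exact: alt_group_scalar.
right; exists n, (H `&` Dmat (R := R)); split.
- exact: alt_sym_inv.
- exact: alt_Omega mE co.
- rewrite cmatE; apply: (eq_ext_of_lift _ _ hP _ _ D aH Hm (eps_neq0 _) Hs HD pD).
  by rewrite he.
Qed.

(** The image of [d o4] under [h] is one of three cube roots of unity; conjugating by (3 4) moves
    the square of [eps 1] to its inverse [eps 1]. *)
Lemma alt_GLconj_inU G : alt_group G -> exists H, inU H /\ GLconj G H.
Proof.
move=> aG; have [m m0 Gm] := alt_exponent _ aG.
have [n [m' [h [mE co hP he]]]] := @exists_power_map R m m0.
have [d [b gp]] := exists_good_pair _ _ _ aG Gm hP.
have [_ _ _ _ [a3 _ _]] := gp.
have [a1|[a1|a1]] : h (d o4) = 1 \/ h (d o4) = eps R 1 \/ h (d o4) = eps R 1 ^+ 2.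
  exact: cube_roots a3 eps1_cube eps1_neq1.
- exact: (alt_GLconj_inU_of_pair _ _ _ _ _ _ _ aG Gm hP mE co he gp (or_introl a1)).
- exact: (alt_GLconj_inU_of_pair _ _ _ _ _ _ _ aG Gm hP mE co he gp (or_intror a1)).
have [d' [b' [gp' a']]] := good_pair_swap _ _ hP _ _ _ aG gp.
have n1 : nowhere0 (fun _ : 'I_5 => 1 : C) by move=> i; rewrite oner_eq0.
have aH := alt_mconj _ _ (tperm o3 o4) n1 aG.
have Hm := alt_mconj_exponent _ _ (tperm o3 o4) _ n1 aG Gm.
have [|K [UK cK]] := alt_GLconj_inU_of_pair _ _ _ _ _ _ _ aH Hm hP mE co he gp'.
  right; rewrite a' a1; apply: (mulfI (expf_neq0 2 (@eps_neq0 R 1))).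
  by rewrite mulfV ?expf_neq0 ?eps_neq0 // -exprSr eps1_cube.
exists K; split=> //; apply: GLconj_trans cK.
by exists (mon (fun=> 1) (tperm o3 o4)); split; first exact: mon_unit.
Qed.

End Existence2.

Theorem theorem8p15 (R : realType) :
  (forall G : set 'M[R[i]]_5, inU G ->
     [/\ finite_subgroup_M G, irreducible G &
         perm_part G = [set t | t \in Alt 'I_5]]) /\
  (forall G : set 'M[R[i]]_5,
     finite_subgroup_M G -> irreducible G ->
     perm_part G = [set t | t \in Alt 'I_5] ->
     exists H, inU H /\ GLconj G H) /\
  (forall G H : set 'M[R[i]]_5, inU G -> inU H -> GLconj G H -> G = H).
Proof.
split; first exact: inU_properties.
split; last exact: inU_GLconj_eq.
move=> G [sG fG GM] iG pG; apply: alt_GLconj_inU; split=> // t.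
rewrite -mem_Alt5 -(perm_partP _ _ sG) pG; exact: iff_refl.
Qed.
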